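(* Let $(R,\mathfrak m)$ be a commutative Noetherian local ring and let $M$ and $N$ be nonzero finitely generated $R$-modules. Assume $N$ is a rigid-test module (e.g., $N=k$, the residue field of $R$). Then: (i) If $\operatorname{Ext}^n_R(M,N)=0$ for some integer $n\ge \operatorname{depth}(N)$, then $\operatorname{pd}_R(M)\le n-1$. (ii) $\operatorname{pd}_R(M)=\sup\{i\in\mathbb Z : \operatorname{Ext}^i_R(M,N)\ne 0\}$. (iii) If $\operatorname{pd}_R(N)<\infty$ or $\operatorname{id}_R(N)<\infty$, then $R$ is regular.
   Context: All modules are finitely generated; $\operatorname{pd}$ and $\operatorname{id}$ denote projective and injective dimension. A finitely generated $R$-module $N$ is called a rigid-test module if for every finitely generated $R$-module $L$ the following holds: if $\operatorname{Tor}^R_n(N,L)=0$ for some $n\ge 1$, then $\operatorname{Tor}^R_{n+1}(N,L)=0$ and $\operatorname{pd}_R(L)<\infty$. *)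

(* Defs.v *)
From HB Require Import structures.
From mathcomp Require Import all_boot all_order all_algebra.
From mathcomp Require Import boolp classical_sets constructive_ereal.

Set Implicit Arguments.
Unset Strict Implicit.
Unset Printing Implicit Defensive.

Import Order.TTheory GRing.Theory Num.Theory.
Local Open Scope classical_set_scope.
Local Open Scope ring_scope.

(* Homological dimensions and depth take values in [\bar int], the integers
   with [-oo] and [+oo] added; every subset of [\bar int] has a supremum and an
   infimum, so the default values below matter only for the empty set. *)
Definition sup_bar (A : set (\bar int)) : \bar int := supremum -oo%E A.
Definition inf_bar (A : set (\bar int)) : \bar int := infimum +oo%E A.

Section Rings.
Variable R : comNzRingType.

(* [idealr_closed] already requires [1 \notin I]. *)
Definition prime_ideal (I : {pred R}) : Prop :=
  idealr_closed I /\ prime_idealr_closed I.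

Definition maximal_ideal (I : {pred R}) : Prop :=
  idealr_closed I /\
  forall J : {pred R}, idealr_closed J -> {subset I <= J} -> J =i I.

Definition generates (s : seq R) (I : {pred R}) : Prop :=
  forall x : R,
    x \in I <-> exists c : 'I_(size s) -> R, x = \sum_(i < size s) c i * s`_i.

(* The improper ideal is generated by 1, so proper ideals suffice. *)
Definition noetherian : Prop :=
  forall I : {pred R}, idealr_closed I -> exists s : seq R, generates s I.

Definition local_ring (m : {pred R}) : Prop :=
  maximal_ideal m /\ forall I : {pred R}, maximal_ideal I -> I =i m.

Definition prime_chain (n : nat) (p : nat -> {pred R}) : Prop :=
  (forall i, (i <= n)%N -> prime_ideal (p i)) /\
  (forall i, (i < n)%N ->
     {subset p i <= p i.+1} /\ exists2 x, x \in p i.+1 & x \notin p i).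

Definition krull_dim : \bar int :=
  sup_bar [set (n%:Z)%:E | n in [set n : nat | exists p, prime_chain n p]].

(* For a Noetherian local ring: the maximal ideal is generated by
   [krull_dim] many elements. *)
Definition regular_local (m : {pred R}) : Prop :=
  exists2 s : seq R, generates s m & krull_dim = ((size s)%:Z)%:E.

End Rings.

Section Modules.
Variable R : comNzRingType.

Definition fin_gen (M : lmodType R) : Prop :=
  exists s : seq M, forall x : M,
    exists c : 'I_(size s) -> R, x = \sum_(i < size s) c i *: s`_i.

Definition zero_module (M : lmodType R) : Prop := forall x : M, x = 0.

Definition surjective_fun (A B : Type) (f : A -> B) : Prop :=
  forall y, exists x, f x = y.

Definition exact_pair (A B C : lmodType R) (f : A -> B) (g : B -> C) : Prop :=
  forall y : B, g y = 0 <-> exists x : A, f x = y.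

Definition projective (P : lmodType R) : Prop :=
  forall (A B : lmodType R) (f : {linear A -> B}) (g : {linear P -> B}),
    surjective_fun f ->
    exists h : {linear P -> A}, forall x, f (h x) = g x.

Definition injective_module (E : lmodType R) : Prop :=
  forall (A B : lmodType R) (f : {linear A -> B}) (g : {linear A -> E}),
    injective f ->
    exists h : {linear B -> E}, forall x, h (f x) = g x.

Record proj_resolution (M : lmodType R) := ProjResolution {
  pobj : nat -> lmodType R;
  pdiff : forall n, {linear pobj n.+1 -> pobj n};
  paug : {linear pobj 0%N -> M};
  pobj_projective : forall n, projective (pobj n);
  paug_surj : surjective_fun paug;
  paug_exact : exact_pair (pdiff 0%N) paug;
  pdiff_exact : forall n, exact_pair (pdiff n.+1) (pdiff n)
}.

Record inj_resolution (M : lmodType R) := InjResolution {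
  iobj : nat -> lmodType R;
  idiff : forall n, {linear iobj n -> iobj n.+1};
  iaug : {linear M -> iobj 0%N};
  iobj_injective : forall n, injective_module (iobj n);
  iaug_inj : injective iaug;
  iaug_exact : exact_pair iaug (idiff 0%N);
  idiff_exact : forall n, exact_pair (idiff n) (idiff n.+1)
}.

(* [d] ranges over all integers, so the zero module has dimension [-oo]. *)
Definition pd (M : lmodType R) : \bar int :=
  inf_bar [set d%:E | d in [set d : int |
    exists P : proj_resolution M,
      forall i : nat, d < i%:Z -> zero_module (pobj P i)]].

Definition injdim (M : lmodType R) : \bar int :=
  inf_bar [set d%:E | d in [set d : int |
    exists I : inj_resolution M,
      forall i : nat, d < i%:Z -> zero_module (iobj I i)]].

(* The cohomology of [Hom(P, N)] vanishes in degree [n]. *)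
Definition Hom_acyclic_at (M N : lmodType R) (P : proj_resolution M)
    (n : nat) : Prop :=
  forall phi : {linear pobj P n -> N},
    (forall x, phi (pdiff P n x) = 0) ->
    match n return {linear pobj P n -> N} -> Prop with
    | 0 => fun phi => forall x, phi x = 0
    | k.+1 => fun phi =>
        exists psi : {linear pobj P k -> N}, forall x, phi x = psi (pdiff P k x)
    end phi.

(* [Ext^n(M, N) = 0]. Projective resolutions exist and the cohomology does not
   depend on the resolution, so "some" could equivalently be "every".
   Ext vanishes in negative degrees. *)
Definition Ext_vanishes (n : int) (M N : lmodType R) : Prop :=
  match n with
  | Posz k => exists P : proj_resolution M, Hom_acyclic_at N P k
  | Negz _ => True
  end.

Definition bilinear_map (A B C : lmodType R) (f : A -> B -> C) : Prop :=
  (forall a, linear (f a)) /\ (forall b, linear (f^~ b)).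

(* [T], with the bilinear map [t], is a tensor product of [A] and [B]. *)
Definition is_tensor (A B T : lmodType R) (t : A -> B -> T) : Prop :=
  bilinear_map t /\
  forall (C : lmodType R) (f : A -> B -> C), bilinear_map f ->
    (exists g : {linear T -> C}, forall a b, g (t a b) = f a b) /\
    (forall g g' : {linear T -> C},
       (forall a b, g (t a b) = f a b) -> (forall a b, g' (t a b) = f a b) ->
       g =1 g').

(* The complex [N (x) P], up to isomorphism. *)
Record tensor_complex (N L : lmodType R) (P : proj_resolution L) :=
  TensorComplex {
  tobj : nat -> lmodType R;
  tdiff : forall n, {linear tobj n.+1 -> tobj n};
  tpair : forall n, N -> pobj P n -> tobj n;
  tpair_tensor : forall n, is_tensor (@tpair n);
  tdiffE : forall n x y, tdiff n (@tpair n.+1 x y) = @tpair n x (pdiff P n y)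
}.

(* [Tor_n(N, L) = 0], as the homology of [N (x) P] for a projective resolution
   [P] of [L]; the choices of [P] and of the tensor products are immaterial. *)
Definition Tor_vanishes (n : nat) (N L : lmodType R) : Prop :=
  exists (P : proj_resolution L) (T : tensor_complex N P),
    match n with
    | 0 => surjective_fun (tdiff T 0%N)
    | k.+1 => exact_pair (tdiff T k.+1) (tdiff T k)
    end.

Definition rigid_test (N : lmodType R) : Prop :=
  fin_gen N /\
  forall L : lmodType R, fin_gen L ->
  forall n : nat, (1 <= n)%N -> Tor_vanishes n N L ->
    Tor_vanishes n.+1 N L /\ (pd L < +oo)%E.

(* [v] lies in [(s_0, ..., s_(r-1)) N]. *)
Definition in_smul (N : lmodType R) (s : seq R) (v : N) : Prop :=
  exists w : 'I_(size s) -> N, v = \sum_(i < size s) s`_i *: w i.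

Definition regular_seq (N : lmodType R) (s : seq R) : Prop :=
  (forall i, (i < size s)%N -> forall v : N,
     in_smul (take i s) (s`_i *: v) -> in_smul (take i s) v) /\
  exists v : N, ~ in_smul s v.

Definition depth (m : {pred R}) (N : lmodType R) : \bar int :=
  sup_bar [set ((size s)%:Z)%:E | s in [set s : seq R |
    {subset s <= m} /\ regular_seq N s]].

End Modules.

(* Main.v *)
(* Let F be the minimal free resolution of M, let n >= 1 with Ext^n(M, N) = 0, and
   let Y be the cokernel of the dual of F_(n+1) -> F_n. Then Tor_1(N, Y) = 0, so all
   Tor_i(N, Y) with i >= 1 vanish and pd Y is finite. Vanishing of Tor_2 gives
   Ext^n(M, R) (x) N = 0, hence Ext^n(M, R) = 0 by Nakayama, so that the dual of
   F_(n+1) -> F_n starts a minimal resolution G of Y. Since N (x) G is acyclic, G has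
   length at most depth N <= n. The canonical map from the dual of G to F is then
   null-homotopic, and it is the identity on F_n; minimality forces F_n = 0.

   Part (ii) follows from (i) and Nakayama, because depth N is bounded by the Krull
   dimension and the latter by the number e of minimal generators of the maximal
   ideal, by Krull's principal ideal theorem.

   In (iii) dimension shifting and (i) or rigidity show that the residue field k has
   finite projective dimension. Composing e homotopies for multiplication by the
   generators of the maximal ideal shows that the e-th module of the minimal
   resolution of k is nonzero, so e <= pd k <= depth R <= dim R <= e. *)

Require Import Defs.
From HB Require Import structures.
From mathcomp Require Import all_boot all_order all_algebra.
From mathcomp Require Import boolp classical_sets constructive_ereal.
From mathcomp Require Import ring zify.

Set Implicit Arguments.
Unset Strict Implicit.
Unset Printing Implicit Defensive.

Import Order.TTheory GRing.Theory Num.Theory.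
Local Open Scope classical_set_scope.
Local Open Scope ring_scope.

(** * Submodules and Noetherian modules *)

(** Transposition is what turns Ext into Tor. For free modules given by matrices, Hom(F, N) and N
    (x) F are both tuples of elements of N acted on by matrices, in the first case by the transposed
    ones, and [texact] states exactness of either. Thus Ext^n(M, N) = 0 says that N tensored with
    the dual of F is exact in degree n. The dual complex itself need not be exact there, but its
    incoming map factors through a true resolution of Y, which only enlarges the image; hence
    Tor_1(N, Y) = 0. Tor and Ext are given by some unspecified resolution, so vanishing must be
    carried to the minimal one before matrices can be used. Dimension theory enters because (i) says
    nothing if depth N is infinite, while (ii) for infinite pd M needs it in all large degrees.
    Localizations are never formed there: a statement about the localization at p is one that holds
    after multiplication by an element outside p. *)

Section Submodules.
Variable R : comNzRingType.
Implicit Types V W : lmodType R.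

Definition submod V (S : V -> Prop) : Prop :=
  S 0 /\ forall a x y, S x -> S y -> S (a *: x + y).

Section Closure.
Variables (V : lmodType R) (S : V -> Prop).
Hypothesis hS : submod S.

Lemma submod0 : S 0. Proof. exact: hS.1. Qed.

Lemma submodD x y : S x -> S y -> S (x + y).
Proof. by move=> Sx Sy; rewrite -[x]scale1r; exact: hS.2. Qed.

Lemma submodZ a x : S x -> S (a *: x).
Proof. by move=> Sx; rewrite -[_ *: _]addr0; apply: hS.2 => //; exact: submod0. Qed.

Lemma submodN x : S x -> S (- x).
Proof. by move=> Sx; rewrite -scaleN1r; exact: submodZ. Qed.

Lemma submodB x y : S x -> S y -> S (x - y).
Proof. by move=> Sx Sy; apply: submodD => //; exact: submodN. Qed.

Lemma submod_sum I (r : seq I) (P : pred I) (F : I -> V) :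
  (forall i, P i -> S (F i)) -> S (\sum_(i <- r | P i) F i).
Proof. by move=> h; elim/big_ind: _ => //; [exact: submod0 | exact: submodD]. Qed.

End Closure.

Lemma submod_setT V : submod (fun _ : V => True). Proof. by []. Qed.

Lemma submod_ker V W (f : {linear V -> W}) : submod (fun x => f x = 0).
Proof.
by split=> [|a x y fx fy]; rewrite ?linear0 // linearP fx fy scaler0 addr0.
Qed.

Lemma submod_im V W (f : {linear V -> W}) (S : V -> Prop) :
  submod S -> submod (fun y => exists2 x, S x & f x = y).
Proof.
move=> hS; split=> [|a _ _ [x Sx <-] [y Sy <-]].
  by exists 0; [exact: submod0 | exact: linear0].
by exists (a *: x + y); [exact: hS.2 | exact: linearP].
Qed.

Lemma submod_range V W (f : {linear V -> W}) : submod (fun y => exists x, f x = y).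
Proof.
split=> [|a _ _ [x <-] [y <-]]; first by exists 0; exact: linear0.
by exists (a *: x + y); exact: linearP.
Qed.

Lemma submodI V (S T : V -> Prop) :
  submod S -> submod T -> submod (fun x => S x /\ T x).
Proof.
move=> hS hT; split; first by split; exact: submod0.
by move=> a x y [Sx Tx] [Sy Ty]; split; [exact: hS.2 | exact: hT.2].
Qed.

(** Recursion on the list lets inductions remove one generator at a time; [spanP] gives back the
    indexed sums of [generates] and [fin_gen]. *)
Fixpoint span V (s : seq V) (x : V) : Prop :=
  if s is y :: t then exists c : R, span t (x - c *: y) else x = 0.

Lemma spanP V (s : seq V) (x : V) :
  span s x <-> exists c : 'I_(size s) -> R, x = \sum_(i < size s) c i *: s`_i.
Proof.
elim: s x => [|y t IH] x /=.
  split=> [->|[c ->]]; last by rewrite big_ord0.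
  by exists (fun _ => 0); rewrite big_ord0.
split=> [[a /IH[c e]]|[c ->]].
  exists (fun i => if unlift ord0 i is Some j then c j else a).
  rewrite big_ord_recl unlift_none /= -[x](subrK (a *: y)) e addrC.
  by congr (_ + _); apply: eq_bigr => i _; rewrite liftK.
exists (c ord0); apply/IH; exists (fun i => c (lift ord0 i)).
by rewrite big_ord_recl /= addrC addKr.
Qed.

Lemma span_submod V (s : seq V) : submod (span s).
Proof.
elim: s => [|y t IH] /=; first by split=> // a x z -> ->; rewrite scaler0 addr0.
split=> [|a u v [c hu] [d hv]]; first by exists 0; rewrite scale0r subr0; exact: IH.1.
exists (a * c + d).
suff -> : a *: u + v - (a * c + d) *: y = a *: (u - c *: y) + (v - d *: y) by exact: IH.2.
by rewrite scalerDl scalerBr scalerA opprD addrACA.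
Qed.

Lemma span_mem V (s : seq V) x : x \in s -> span s x.
Proof.
elim: s => //= y t IH; rewrite inE => /orP[/eqP->|/IH h].
  by exists 1; rewrite scale1r subrr; exact: (span_submod t).1.
by exists 0; rewrite scale0r subr0.
Qed.

Lemma span_min V (s : seq V) (S : V -> Prop) :
  submod S -> (forall x, x \in s -> S x) -> forall x, span s x -> S x.
Proof.
move=> hS; elim: s => [|y t IH] h x /=; first by move->; exact: hS.1.
case=> c /IH hx; rewrite -(subrK (c *: y) x); apply: submodD => //.
  by apply: hx => z zt; apply: h; rewrite inE zt orbT.
by apply: submodZ => //; apply: h; rewrite inE eqxx.
Qed.

Definition fgs V (S : V -> Prop) : Prop := exists s : seq V, forall x, S x <-> span s x.

Definition noeth V : Prop := forall S : V -> Prop, submod S -> fgs S.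

(** Lifted generators of the image together with generators of the kernel part suffice: subtracting
    a lift of [f x] from [x] leaves an element of the kernel. *)
Lemma fgs_ext V W (f : {linear V -> W}) (S : V -> Prop) : submod S ->
  fgs (fun y => exists2 x, S x & f x = y) -> fgs (fun x => S x /\ f x = 0) -> fgs S.
Proof.
move=> hS [s hs] [t ht].
have [s' [hs' es]] : exists s', (forall x, x \in s' -> S x) /\ map f s' = s.
  have : forall y, y \in s -> exists2 x, S x & f x = y.
    by move=> y ys; apply/hs; exact: span_mem.
  elim: s {hs} => [|y s IH] h; first by exists [::].
  have [|s' [h1 h2]] := IH; first by move=> z zs; apply: h; rewrite inE zs orbT.
  have [x Sx fx] := h y (mem_head _ _).
  exists (x :: s'); split=> /=; last by rewrite fx h2.
  by move=> z; rewrite inE => /orP[/eqP->|/h1].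
have tS x : x \in t -> S x by move=> xt; have [] := (ht x).2 (span_mem xt).
exists (s' ++ t) => x; split; last first.
  apply: span_min => // z; rewrite mem_cat => /orP[/hs'|/tS] //.
move=> Sx.
have sub1 : forall z, span s' z -> span (s' ++ t) z.
  by apply: span_min => [|z zs]; [exact: span_submod | apply: span_mem; rewrite mem_cat zs].
have sub2 : forall z, span t z -> span (s' ++ t) z.
  by apply: span_min => [|z zs]; [exact: span_submod | apply: span_mem; rewrite mem_cat zs orbT].
have : span s (f x) by apply/hs; exists x.
have lift y : span s y -> exists2 z, span s' z & f z = y.
  rewrite -es => hy; apply: span_min (submod_im _ (span_submod s')) _ _ hy.
  by move=> _ /mapP[z zs ->]; exists z => //; exact: span_mem.
move=> /lift[z zs fz]; rewrite -(subrK z x).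
apply: submodD; [exact: span_submod | apply: sub2 | exact: sub1].
apply/ht; split; last by rewrite linearB fz subrr.
by apply: submodB => //; apply: span_min zs.
Qed.

Lemma noeth_im V W (f : {linear V -> W}) : surjective_fun f -> noeth V -> noeth W.
Proof.
move=> fs nV S hS.
have [|s hs] := nV (fun x => S (f x)).
  by split=> [|a x y Sx Sy]; rewrite ?linear0 ?linearP; [exact: hS.1 | exact: hS.2].
exists (map f s) => y; split=> [Sy|].
  have [x fx] := fs y; subst y; have /hs : S (f x) by [].
  have : submod (fun x => span (map f s) (f x)).
    have hm := span_submod (map f s).
    by split=> [|a u v hu hv]; rewrite ?linear0 ?linearP; [exact: hm.1 | exact: hm.2].
  by move=> hsub; apply: (span_min hsub) => // z zs; apply: span_mem; exact: map_f.
apply: (span_min hS) => // _ /mapP[x xs ->]; apply/hs; exact: span_mem.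
Qed.

(** Without a maximal member, choice yields a strictly increasing chain; the finitely many
    generators of its union already lie in one member, which ends the chain. *)
Lemma noeth_max V (P : (V -> Prop) -> Prop) : noeth V ->
  (forall S, P S -> submod S) -> (exists S, P S) ->
  exists2 S, P S & forall T, P T -> (forall x, S x -> T x) -> forall x, T x -> S x.
Proof.
move=> nV Psub [S0 PS0]; apply: contrapT => no.
have step (S : {S | P S}) : exists T : {S | P S},
    (forall x, sval S x -> sval T x) /\ exists x, sval T x /\ ~ sval S x.
  case: S => S PS /=; apply: contrapT => h; apply: no; exists S => // T PT sub x Tx.
  apply: contrapT => nSx; apply: h.
  by exists (exist _ T PT); split=> //; exists x.
pose nx S := sval (cid (step S)).
pose c n := iter n nx (exist _ S0 PS0).
have cS n x : sval (c n) x -> sval (c n.+1) x.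
  by move: x; exact: (svalP (cid (step (c n)))).1.
have cle n k x : sval (c n) x -> sval (c (k + n)%N) x.
  by move=> h; elim: k => // k IH; exact: cS.
have cle' n k x : (n <= k)%N -> sval (c n) x -> sval (c k) x.
  by move=> nk /cle h; rewrite -(subnK nk); exact: h.
have [|s hs] := nV (fun x => exists n, sval (c n) x).
  split; first by exists 0%N; exact: (Psub _ PS0).1.
  move=> a x y [n xn] [k yk]; exists (maxn n k).
  apply: (Psub _ (svalP (c _))).2; first exact: cle' (leq_maxl _ _) xn.
  exact: cle' (leq_maxr _ _) yk.
have [n hn] : exists n, forall x, x \in s -> sval (c n) x.
  have : forall x, x \in s -> exists n, sval (c n) x.
    by move=> x xs; apply/hs; exact: span_mem.
  elim: s {hs} => [|y s IH] h; first by exists 0%N.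
  have [|n hn] := IH; first by move=> x xs; apply: h; rewrite inE xs orbT.
  have [k hk] := h y (mem_head _ _).
  exists (maxn n k) => x; rewrite inE => /orP[/eqP->|/hn xn].
    exact: cle' (leq_maxr _ _) hk.
  exact: cle' (leq_maxl _ _) xn.
have [_ [x [x1 x2]]] := svalP (cid (step (c n))).
apply: x2; apply: (@span_min V s _ (Psub _ (svalP (c n))) hn); apply/hs.
by exists n.+1.
Qed.

(* Local at [p] in the sense that [t *: a] stands for the image of [a] in the
   localization whenever [t] is outside [p]. *)
Lemma nakayama_local V (p : R -> Prop) (U : V -> Prop) (s : seq V) :
  submod (V := R^o) p -> ~ p 1 -> (forall x y, p (x * y) -> p x \/ p y) ->
  submod U ->
  (forall a, a \in s -> exists2 t, ~ p t & exists2 c : 'I_(size s) -> R,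
     (forall i, p (c i)) & U (t *: a - \sum_(i < size s) c i *: s`_i)) ->
  forall a, span s a -> exists2 t, ~ p t & U (t *: a).
Proof.
move=> hp p1 pM hU.
have pm x y : ~ p x -> ~ p y -> ~ p (x * y) by move=> nx ny /pM[].
(* [pspan s x]: up to a combination of [s] with coefficients in [p], [x] lies in [U]. *)
pose pspan := fix pspan (s : seq V) x : Prop :=
  if s is y :: t then exists2 c : R, p c & pspan t (x - c *: y) else U x.
have pspanD s' a x y : pspan s' x -> pspan s' y -> pspan s' (a *: x + y).
  elim: s' x y => [|z s' IH] x y /=; first exact: hU.2.
  move=> [c pc hc] [d pd hd]; exists (a * c + d); first exact: hp.2.
  suff -> : a *: x + y - (a * c + d) *: z = a *: (x - c *: z) + (y - d *: z) by exact: IH.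
  by rewrite scalerDl scalerBr scalerA opprD addrACA.
have pspanU s' x : U x -> pspan s' x.
  elim: s' x => //= z s' IH x Ux; exists 0; first exact: hp.1.
  by rewrite scale0r subr0; exact: IH.
have satU : submod (fun a => exists2 t, ~ p t & U (t *: a)).
  split=> [|a x y [t pt Ut] [u pu Uu]]; first by exists 1 => //; rewrite scaler0; exact: hU.1.
  exists (t * u); first exact: pm.
  rewrite scalerDr !scalerA [t * u * a](_ : _ = (u * a) * t); last by ring.
  by rewrite [t * u]mulrC -scalerA; apply: hU.2 => //; rewrite [u * t]mulrC -scalerA; exact: submodZ.
have pspanP s' x : (exists2 c : 'I_(size s') -> R, (forall i, p (c i)) &
    U (x - \sum_(i < size s') c i *: s'`_i)) -> pspan s' x.
  elim: s' x => [|y s' IH] x /= [c pc]; first by rewrite big_ord0 subr0.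
  rewrite big_ord_recl /= opprD addrA => h; exists (c ord0) => //; apply: IH.
  by exists (fun i => c (lift ord0 i)).
move=> h; have {}h a : a \in s -> exists2 t, ~ p t & pspan s (t *: a).
  by move=> /h[t pt hc]; exists t => //; exact: pspanP.
apply: span_min => //; elim: s h => //= y s IH h.
have [t pt [c pc hy]] := h y (mem_head _ _).
have {}hy : pspan s ((t - c) *: y) by rewrite scalerBl.
(* Locally at [p] the factor [t - c] is a unit, so [hy] expresses [y] by the remaining generators
   and [y] can be eliminated from their relations. *)
have ptc : ~ p (t - c).
  by move=> h1; apply: pt; rewrite -(subrK c t); exact: (submodD hp).
have {}IH b : b \in s -> exists2 t, ~ p t & U (t *: b).
  apply: IH => b' b's; have [|t' pt' [c' pc' hb]] := h b'; first by rewrite inE b's orbT.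
  exists ((t - c) * t'); first exact: pm.
  have := pspanD _ (t - c) _ _ hb (pspanD _ c' _ _ hy (pspanU s _ hU.1)).
  by rewrite addr0 scalerBr !scalerA [c' * _]mulrC subrK.
move=> b; rewrite inE => /orP[/eqP->|/IH //].
have : exists2 u, ~ p u & U (u *: ((t - c) *: y)).
  move: hy; move: (_ *: y) => z; elim: s z IH {h} => [|w s IHs] z IH /=.
    by exists 1 => //; rewrite scale1r.
  case=> d pd /IHs[|t' pt' Ut'] ; first by move=> b' b's; apply: IH; rewrite inE b's orbT.
  rewrite -(subrK (d *: w) z); apply: (submodD satU); first by exists t'.
  by apply: (submodZ satU); apply: IH; rewrite mem_head.
by case=> u pu; rewrite scalerA => Uu; exists (u * (t - c)) => //; exact: pm.
Qed.

End Submodules.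

(** * Tuples of module elements and the action of matrices on them *)

Section Tuples.
Variable R : comNzRingType.
Implicit Types V W : lmodType R.

Definition lcomb V n (w : {ffun 'I_n -> V}) (v : 'rV[R]_n) : V :=
  \sum_i v 0 i *: w i.

Lemma lcomb_is_linear V n (w : {ffun 'I_n -> V}) : linear (lcomb w).
Proof.
move=> a u v; rewrite /lcomb scaler_sumr -big_split /=; apply: eq_bigr => i _.
by rewrite !mxE scalerDl scalerA.
Qed.

HB.instance Definition _ V n (w : {ffun 'I_n -> V}) :=
  GRing.isLinear.Build R 'rV[R]_n V _ (lcomb w) (lcomb_is_linear w).

(* [tmap A] is multiplication by [A] on tuples of elements of [V], that is
   [V (x) A] for the map [A : R^p -> R^q] of free modules. *)
Definition tmap V p q (A : 'M[R]_(p, q)) (w : {ffun 'I_p -> V}) : {ffun 'I_q -> V} :=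
  [ffun j => \sum_i A i j *: w i].

Lemma tmap_is_linear V p q (A : 'M[R]_(p, q)) : linear (@tmap V p q A).
Proof.
move=> a u v; apply/ffunP => j; rewrite !ffunE scaler_sumr -big_split /=.
apply: eq_bigr => i _; rewrite !ffunE scalerDr !scalerA.
by congr (_ *: _ + _); rewrite mulrC.
Qed.

HB.instance Definition _ V p q (A : 'M[R]_(p, q)) :=
  GRing.isLinear.Build R {ffun 'I_p -> V} {ffun 'I_q -> V} _ (tmap A)
    (@tmap_is_linear V p q A).

Lemma lcomb_delta V n (w : {ffun 'I_n -> V}) i : lcomb w (delta_mx 0 i) = w i.
Proof.
rewrite /lcomb (bigD1 i) //= mxE !eqxx scale1r big1 ?addr0 // => j ji.
by rewrite mxE eqxx (negPf ji) scale0r.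
Qed.

Lemma lin_lcomb V n (f : {linear 'rV[R]_n -> V}) v :
  f v = lcomb [ffun i => f (delta_mx 0 i)] v.
Proof.
rewrite {1}[v]row_sum_delta linear_sum; apply: eq_bigr => i _.
by rewrite linearZ ffunE.
Qed.

Lemma lin_comb V W n (f : {linear V -> W}) (w : {ffun 'I_n -> V}) v :
  f (lcomb w v) = lcomb [ffun i => f (w i)] v.
Proof. by rewrite linear_sum; apply: eq_bigr => i _; rewrite linearZ ffunE. Qed.

Lemma lcomb_inj V n (w w' : {ffun 'I_n -> V}) : lcomb w =1 lcomb w' -> w = w'.
Proof. by move=> h; apply/ffunP => i; rewrite -!lcomb_delta h. Qed.

Lemma lcomb_mul V p q (A : 'M[R]_(q, p)) (w : {ffun 'I_p -> V}) v :
  lcomb w (v *m A) = lcomb (tmap A^T w) v.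
Proof.
rewrite /lcomb; under eq_bigr => j _ do rewrite mxE scaler_suml.
rewrite exchange_big; apply: eq_bigr => i _ /=; rewrite ffunE scaler_sumr.
by apply: eq_bigr => j _; rewrite mxE scalerA.
Qed.

Lemma tmap_mul V p q r (A : 'M[R]_(p, q)) (B : 'M[R]_(q, r)) (w : {ffun 'I_p -> V}) :
  tmap (A *m B) w = tmap B (tmap A w).
Proof.
apply/ffunP => k; rewrite !ffunE.
under eq_bigr => i _ do rewrite mxE scaler_suml.
rewrite exchange_big; apply: eq_bigr => j _ /=; rewrite ffunE scaler_sumr.
by apply: eq_bigr => i _; rewrite scalerA mulrC.
Qed.

Lemma tmap0 V p q (w : {ffun 'I_p -> V}) : tmap (0 : 'M_(p, q)) w = 0.
Proof. by apply/ffunP => j; rewrite !ffunE big1 // => i _; rewrite mxE scale0r. Qed.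

Definition tlin V W p (f : V -> W) (w : {ffun 'I_p -> V}) : {ffun 'I_p -> W} :=
  [ffun i => f (w i)].

Lemma tmap_lin V W p q (f : {linear V -> W}) (A : 'M[R]_(p, q)) (w : {ffun 'I_p -> V}) :
  tmap A (tlin f w) = tlin f (tmap A w).
Proof.
apply/ffunP => j; rewrite !ffunE linear_sum; apply: eq_bigr => i _.
by rewrite ffunE linearZ.
Qed.

Lemma span_lcomb V (s : seq V) x :
  span s x <-> exists v, lcomb [ffun i : 'I_(size s) => s`_i] v = x.
Proof.
split=> [/spanP[c ->]|[v <-]].
  exists (\row_i c i); apply: eq_bigr => i _; by rewrite mxE ffunE.
by apply/spanP; exists (v 0); apply: eq_bigr => i _; rewrite ffunE.
Qed.

Lemma fin_genP V : fin_gen V <-> exists n (w : {ffun 'I_n -> V}), surjective_fun (lcomb w).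
Proof.
split=> [[s hs]|[n [w hw]]].
  exists (size s), [ffun i : 'I_(size s) => s`_i] => x; apply/span_lcomb/spanP; exact: hs.
have [v hv] : exists s : seq V, forall x, span s x.
  exists (codom w) => x; have [v <-] := hw x.
  apply: submod_sum; first exact: span_submod.
  by move=> i _; apply: submodZ; [exact: span_submod | apply: span_mem; exact: codom_f].
by exists v => x; apply/spanP.
Qed.

(** [noetherian] speaks of proper ideals only, since [idealr_closed] excludes 1; the unit ideal is
    the separate first case. *)
Lemma noeth_ring : noetherian R -> noeth R^o.
Proof.
move=> hR S hS; have [S1|S1] := pselect (S 1).
  exists [:: 1] => x; split=> [_|_].
    by exists x; rewrite /GRing.scale /= mulr1 subrr.
  rewrite -[x]mulr1; exact: (submodZ hS x S1).
have [|s hs] := hR [pred x | `[<S x>]].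
  split; first by rewrite inE; exact: hS.1.
    by apply/negP; rewrite inE.
  by move=> a x y; rewrite !inE; exact: hS.2.
exists s => x; split=> [Sx|/spanP h].
  by apply/spanP; apply/hs; rewrite inE.
by have := (hs x).2 h; rewrite inE.
Qed.

Definition mxcoord n (i : 'I_n) (v : 'rV[R]_n) : R^o := v 0 i.

Lemma mxcoord_is_linear n (i : 'I_n) : linear (mxcoord i).
Proof. by move=> a u v; rewrite /mxcoord !mxE. Qed.

HB.instance Definition _ n (i : 'I_n) :=
  GRing.isLinear.Build R 'rV[R]_n R^o _ (mxcoord i) (mxcoord_is_linear i).

(** Induction on the number [k] of leading coordinates that may be nonzero: the last of them maps
    the submodule to an ideal, with kernel covered by the induction. *)
Lemma noeth_rV n : noeth R^o -> noeth 'rV[R]_n.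
Proof.
move=> nR S hS.
suff h k (T : 'rV[R]_n -> Prop) : (k <= n)%N -> submod T ->
    (forall v, T v -> forall i : 'I_n, (k <= i)%N -> v 0 i = 0) -> fgs T.
  by apply: (h n) => // v _ i; rewrite leqNgt ltn_ord.
elim: k T => [|k IH] T kn hT Tk.
  exists [::] => x; split=> [Tx|->]; last exact: hT.1.
  by apply/rowP => i; rewrite mxE; exact: Tk.
pose f : {linear 'rV[R]_n -> R^o} := mxcoord (Ordinal kn).
apply: (@fgs_ext _ _ _ f) => //; first by apply: nR; exact: submod_im.
apply: IH; [exact: ltnW | by apply: submodI => //; exact: submod_ker |].
move=> v [Tv fv] i; rewrite leq_eqVlt => /orP[/eqP ki|]; last exact: Tk.
by rewrite -[RHS]fv /f /= /mxcoord; congr (v 0 _); apply/val_inj.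
Qed.

Lemma noeth_fin_gen V : noeth R^o -> fin_gen V -> noeth V.
Proof. by move=> nR /fin_genP[n [w hw]]; exact: noeth_im hw (noeth_rV nR). Qed.

End Tuples.

(** * Local rings *)

Section Local.
Variable R : comNzRingType.
Implicit Types V W : lmodType R.

Definition is_ideal (I : R -> Prop) : Prop := I 0 /\ forall a x y, I x -> I y -> I (a * x + y).

Definition is_prime (p : R -> Prop) : Prop :=
  [/\ is_ideal p, ~ p 1 & forall x y, p (x * y) -> p x \/ p y].

Definition is_local (m : R -> Prop) : Prop :=
  [/\ is_ideal m, ~ m 1 & forall x, ~ m x -> exists y, y * x = 1].

Lemma idealD (I : R -> Prop) x y : is_ideal I -> I x -> I y -> I (x + y).
Proof. by move=> hI; exact: (@submodD R R^o I hI x y). Qed.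
Lemma idealB (I : R -> Prop) x y : is_ideal I -> I x -> I y -> I (x - y).
Proof. by move=> hI; exact: (@submodB R R^o I hI x y). Qed.
Lemma idealN (I : R -> Prop) x : is_ideal I -> I x -> I (- x).
Proof. by move=> hI; exact: (@submodN R R^o I hI x). Qed.
Lemma idealM (I : R -> Prop) a x : is_ideal I -> I x -> I (a * x).
Proof. by move=> hI; exact: (@submodZ R R^o I hI a x). Qed.
Lemma idealMl (I : R -> Prop) a x : is_ideal I -> I x -> I (x * a).
Proof. by rewrite mulrC; exact: idealM. Qed.
Lemma ideal_sum (I : R -> Prop) J (r : seq J) (P : pred J) (F : J -> R) : is_ideal I ->
  (forall i, P i -> I (F i)) -> I (\sum_(i <- r | P i) F i).
Proof. by move=> hI; exact: (@submod_sum R R^o I hI J r P F). Qed.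

Lemma primeM p x y : is_prime p -> ~ p x -> ~ p y -> ~ p (x * y).
Proof. by move=> [_ _ h] nx ny /h[]. Qed.

Lemma prime_exp p x n : is_prime p -> p (x ^+ n) -> p x.
Proof.
move=> hp; elim: n => [|n IH]; first by rewrite expr0; case: hp.
by rewrite exprS; case: (hp) => _ _ h /h[|/IH].
Qed.

(** A non-unit [x] generates a proper ideal; the Noetherian property gives a maximal one among the
    proper ideals containing [x], and it is [m] by uniqueness. *)
Lemma local_ringP (m : {pred R}) : noetherian R -> local_ring m ->
  is_local (fun x => x \in m).
Proof.
move=> nR [[[m0 m1 mI] _] muniq]; split=> //; first exact/negP.
move=> x xm; apply: contrapT => nu.
pose P (J : R^o -> Prop) := [/\ submod J, ~ J 1 & J x].
have [||J [hJ J1 Jx] Jmax] := @noeth_max R R^o P (noeth_ring nR).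
- by move=> S [].
- exists (fun z => exists a, a * x = z); split; last by exists 1; rewrite mul1r.
    split=> [|a _ _ [b <-] [c <-]]; first by exists 0; rewrite mul0r.
    by exists (a * b + c); rewrite mulrDl -mulrA.
  by [].
have idJ : idealr_closed [pred z | `[<J z>]].
  split; first by rewrite inE; exact: hJ.1.
    by apply/negP; rewrite inE.
  by move=> a u v; rewrite !inE; exact: hJ.2.
case: xm; rewrite -(muniq [pred z | `[<J z>]]) ?inE //.
split=> // K [K0 K1 hK] sub z; rewrite inE; apply/idP/asboolP => [Kz|Jz].
  apply: (Jmax (fun z => z \in K)) => //; last by move=> u Ju; apply: sub; rewrite inE.
  by split=> //; [exact/negP | apply: sub; rewrite inE].
by apply: sub; rewrite inE.
Qed.

Section LocalTheory.
Variable m : R -> Prop.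
Hypothesis hm : is_local m.

Lemma local_ideal : is_ideal m. Proof. by case: hm. Qed.

Lemma local_prime : is_prime m.
Proof.
case: hm => mI m1 mU; split=> // x y mxy; apply: contrapT => /not_orP[nx ny].
have [u ux] := mU x nx; apply: ny.
by rewrite -[y]mul1r -ux -mulrA; exact: idealM.
Qed.

Lemma local_sup I : is_ideal I -> ~ I 1 -> forall x, I x -> m x.
Proof.
move=> hI I1 x Ix; apply: contrapT => nmx; have [_ _ mU] := hm.
by have [y yx] := mU x nmx; apply: I1; rewrite -yx; exact: idealM.
Qed.

Lemma nakayama V (U : V -> Prop) (s : seq V) : submod U ->
  (forall a, a \in s -> exists2 c : 'I_(size s) -> R,
     (forall i, m (c i)) & U (a - \sum_(i < size s) c i *: s`_i)) ->
  forall a, span s a -> U a.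
Proof.
move=> hU h a sa; have [mI m1 mU] := hm; have [_ _ mP] := local_prime.
have [|t nt Ut] := @nakayama_local _ V m U s mI m1 mP hU _ a sa.
  by move=> b /h[c mc Ub]; exists 1 => //; exists c; rewrite ?scale1r.
by have [u ut] := mU t nt; rewrite -[a]scale1r -ut -scalerA; exact: submodZ.
Qed.

Definition msub V (S : V -> Prop) (x : V) : Prop :=
  exists n (c : 'I_n -> R) (y : 'I_n -> V),
    [/\ forall i, m (c i), forall i, S (y i) & x = \sum_i c i *: y i].

Lemma nakayama_fgs V (S U : V -> Prop) : submod U -> fgs S ->
  (forall x, S x -> exists2 y, msub S y & U (x - y)) -> forall x, S x -> U x.
Proof.
move=> hU [s hs] h x /hs; apply: nakayama hU _ x => a /span_mem/hs/h[y [n [c [z [mc Sz ->]]]] Uy].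
have /choice[d hd] : forall j, exists d : 'I_(size s) -> R, z j = \sum_(i < size s) d i *: s`_i.
  by move=> j; apply/spanP/hs.
exists (fun i => \sum_j c j * d j i).
  by move=> i; apply: ideal_sum local_ideal _ => j _; rewrite mulrC; apply: idealM local_ideal _.
suff -> : \sum_(i < size s) (\sum_j c j * d j i) *: s`_i = \sum_i c i *: z i by [].
under eq_bigr => i _ do rewrite scaler_suml.
rewrite exchange_big; apply: eq_bigr => j _ /=; rewrite hd scaler_sumr.
by apply: eq_bigr => i _; rewrite scalerA.
Qed.

(** Take the least possible number of generators: a relation with a unit coefficient at [i] would
    express [w i] by the others. *)
Lemma min_gens V (S : V -> Prop) : fgs S ->
  exists n (w : {ffun 'I_n -> V}), (forall x, S x <-> exists v, lcomb w v = x) /\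
    forall v, lcomb w v = 0 -> forall i, m (v 0 i).
Proof.
case=> s hs; pose P n := exists w : {ffun 'I_n -> V}, forall x, S x <-> exists v, lcomb w v = x.
have exP : exists n, `[<P n>].
  exists (size s); apply/asboolP; exists [ffun i : 'I_(size s) => s`_i] => x.
  by split=> [/hs/span_lcomb//|h]; apply/hs/span_lcomb.
case: (ex_minnP exP) => n /asboolP[w hw] nmin; exists n, w; split=> // v wv i.
apply: contrapT => nvi; have [_ _ mU] := hm; have [u uv] := mU _ nvi.
case: n => [|n] in w hw nmin v wv i nvi uv *; first by case: i nvi uv.
suff : P n by move=> /asboolP/nmin; rewrite ltnn.
exists [ffun j => w (lift i j)] => x; rewrite hw; split=> [[z <-]|[z <-]]; last first.
  exists (\row_k if unlift i k is Some j then z 0 j else 0).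
  rewrite /lcomb (bigD1_ord i) //= mxE unlift_none scale0r add0r.
  by apply: eq_bigr => j _; rewrite mxE liftK ffunE.
exists (\row_j (z 0 (lift i j) - z 0 i * u * v 0 (lift i j))).
transitivity (lcomb w (z - (z 0 i * u) *: v)); last first.
  by rewrite linearB linearZ /= wv scaler0 subr0.
rewrite /lcomb (bigD1_ord i) //= !mxE -mulrA uv mulr1 subrr scale0r add0r.
by apply: eq_bigr => j _; rewrite !mxE ffunE.
Qed.

End LocalTheory.

End Local.

(** * Minimal free resolutions *)

Section QuotientModule.
Variables (R : comNzRingType) (V : lmodType R) (S : V -> Prop).
Hypothesis hS : submod S.

Definition quo_rel (x y : V) : bool := `[<S (x - y)>].

Lemma quo_rel_equiv : equiv_class_of quo_rel.
Proof.
split=> [x|x y|y x z]; rewrite /quo_rel.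
- by rewrite subrr; apply/asboolP; exact: hS.1.
- by apply/asboolP/asboolP => h; rewrite -opprB; exact: submodN.
- move=> /asboolP h1 /asboolP h2; apply/asboolP.
  by rewrite -[x](subrK y) -addrA; exact: submodD.
Qed.

Canonical quo_equiv := EquivRelPack quo_rel_equiv.
Canonical quo_enc := defaultEncModRel quo_rel.

Definition quo := {eq_quot quo_rel}%qT.
HB.instance Definition _ : EqQuotient V quo_rel quo := EqQuotient.on quo.
HB.instance Definition _ := Choice.on quo.

Let pi (x : V) : quo := (\pi_quo x)%qT.

Let piP x y : pi x = pi y <-> S (x - y).
Proof. by split=> [/eqmodP/asboolP|h] //; apply/eqmodP/asboolP. Qed.

Let rpi x : S (repr (pi x) - x).
Proof. by apply/piP; rewrite /pi reprK. Qed.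

Definition quo0 : quo := pi 0.
Definition quo_add (x y : quo) : quo := pi (repr x + repr y).
Definition quo_opp (x : quo) : quo := pi (- repr x).
Definition quo_scale (a : R) (x : quo) : quo := pi (a *: repr x).

Let quoW (x : quo) : exists y, x = pi y.
Proof. by exists (repr x); rewrite /pi reprK. Qed.

Let pi_add x y : quo_add (pi x) (pi y) = pi (x + y).
Proof. by apply/piP; rewrite opprD addrACA; exact: submodD. Qed.

Let pi_opp x : quo_opp (pi x) = pi (- x).
Proof. by apply/piP; rewrite -opprD; exact: submodN. Qed.

Let pi_scale a x : quo_scale a (pi x) = pi (a *: x).
Proof. by apply/piP; rewrite -scalerBr; exact: submodZ. Qed.

Lemma quo_addA : associative quo_add.
Proof.
move=> x y z; have [[[x' ->] [y' ->]] [z' ->]] := (quoW x, quoW y, quoW z).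
by rewrite !pi_add addrA.
Qed.

Lemma quo_addC : commutative quo_add.
Proof.
by move=> x y; have [[x' ->] [y' ->]] := (quoW x, quoW y); rewrite !pi_add addrC.
Qed.

Lemma quo_add0 : left_id quo0 quo_add.
Proof. by move=> x; have [x' ->] := quoW x; rewrite pi_add add0r. Qed.

Lemma quo_addN : left_inverse quo0 quo_opp quo_add.
Proof. by move=> x; have [x' ->] := quoW x; rewrite pi_opp pi_add addNr. Qed.

HB.instance Definition _ := GRing.isZmodule.Build quo quo_addA quo_addC quo_add0 quo_addN.

Lemma quo_scaleA a b (x : quo) : quo_scale a (quo_scale b x) = quo_scale (a * b) x.
Proof. by have [x' ->] := quoW x; rewrite !pi_scale scalerA. Qed.

Lemma quo_scale1 : left_id 1 quo_scale.
Proof. by move=> x; have [x' ->] := quoW x; rewrite pi_scale scale1r. Qed.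

Lemma quo_scaleDr : right_distributive quo_scale +%R.
Proof.
move=> a x y; have [[x' ->] [y' ->]] := (quoW x, quoW y).
by rewrite /GRing.add /= pi_add !pi_scale pi_add scalerDr.
Qed.

Lemma quo_scaleDl (x : quo) : {morph quo_scale^~ x : a b / a + b}.
Proof.
move=> a b /=; have [x' ->] := quoW x.
by rewrite {2}/GRing.add /= !pi_scale pi_add scalerDl.
Qed.

HB.instance Definition _ := GRing.Zmodule_isLmodule.Build R quo
  quo_scaleA quo_scale1 quo_scaleDr quo_scaleDl.

Definition quo_pi (x : V) : quo := pi x.

Lemma quo_pi_is_linear : linear quo_pi.
Proof.
by move=> a x y; rewrite /quo_pi {2}/GRing.add /= {2}/GRing.scale /= pi_scale pi_add.
Qed.

HB.instance Definition _ := GRing.isLinear.Build R V quo _ quo_pi quo_pi_is_linear.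

Lemma quo_pi_surj : surjective_fun quo_pi.
Proof. by move=> x; have [y ->] := quoW x; exists y. Qed.

Lemma quo_pi0 x : quo_pi x = 0 <-> S x.
Proof. by rewrite /quo_pi -[0]/(pi 0) piP subr0. Qed.

End QuotientModule.

Section Factor.
Variable R : comNzRingType.

Lemma linear_factor (V Q W : lmodType R) (p : {linear V -> Q}) (f : {linear V -> W}) :
  surjective_fun p -> (forall x, p x = 0 -> f x = 0) ->
  exists g : {linear Q -> W}, forall x, g (p x) = f x.
Proof.
move=> ps h; pose g y := f (sval (cid (ps y))).
have gp x : g (p x) = f x.
  rewrite /g; case: cid => z /= pz; apply/eqP.
  by rewrite -subr_eq0 -linearB h // linearB pz subrr.
have gl : linear g.
  move=> a y z; have [y' <-] := ps y; have [z' <-] := ps z.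
  by rewrite -linearP !gp linearP.
pose G := GRing.isLinear.Build R Q W _ g gl.
pose g' : {linear Q -> W} := HB.pack g G.
by exists g'.
Qed.

End Factor.

(** * Complexes of free modules and existence of minimal resolutions *)

Section Complexes.
Variable R : comNzRingType.

(* A complex of free modules [R^(rk 0) <- R^(rk 1) <- ..], the differentials acting
   on row vectors by [v |-> v *m dm i]. *)
Record fcx := Fcx {
  rk : nat -> nat;
  dm : forall i, 'M[R]_(rk i.+1, rk i)
}.

Definition fcons n (C : fcx) (B : 'M[R]_(rk C 0, n)) : fcx :=
  Fcx (rk := fun i => if i is j.+1 then rk C j else n)
      (fun i => match i return 'M[R]_(rk C i, if i is j.+1 then rk C j else n) with
                | 0 => B | j.+1 => dm C j end).

Definition ftail (C : fcx) : fcx := Fcx (fun i => dm C i.+1).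

Definition mexact p q r (A : 'M[R]_(p, q)) (B : 'M[R]_(q, r)) : Prop :=
  forall v : 'rV_q, v *m B = 0 <-> exists u, v = u *m A.

Lemma mexact_mul0 p q r (A : 'M[R]_(p, q)) (B : 'M[R]_(q, r)) :
  mexact A B -> A *m B = 0.
Proof.
move=> h; apply/row_matrixP => i; rewrite row0 row_mul; apply/h.
by exists (delta_mx 0 i); rewrite -rowE.
Qed.

Lemma mexact_mx p q r s (A : 'M[R]_(p, q)) (B : 'M[R]_(q, r)) (C : 'M[R]_(s, q)) :
  mexact A B -> C *m B = 0 -> exists D, C = D *m A.
Proof.
move=> h CB; have /choice[u hu] : forall i, exists u, row i C = u *m A.
  by move=> i; apply/h; rewrite -row_mul CB row0.
by exists (\matrix_i u i); apply/row_matrixP => i; rewrite hu row_mul rowK.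
Qed.

Definition exact_cx (C : fcx) : Prop := forall i, mexact (dm C i.+1) (dm C i).

Definition resolves (L : lmodType R) (C : fcx) (e : {ffun 'I_(rk C 0) -> L}) : Prop :=
  [/\ surjective_fun (lcomb e),
      forall v, lcomb e v = 0 <-> exists u, v = u *m dm C 0 & exact_cx C].

Lemma rV_projective n : projective 'rV[R]_n.
Proof.
move=> A B f g fs; have /choice[w hw] : forall i, exists x, f x = g (delta_mx 0 i).
  by move=> i; exact: fs.
exists (lcomb (finfun w)) => v; rewrite lin_comb (lin_lcomb g).
by congr (lcomb _ v); apply/ffunP => i; rewrite !ffunE hw.
Qed.

Definition rmul p q (D : 'M[R]_(p, q)) : {linear 'rV[R]_p -> 'rV[R]_q} := mulmxr D.

Definition fres_proj (L : lmodType R) (C : fcx) (e : {ffun 'I_(rk C 0) -> L})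
    (h : resolves e) : proj_resolution L.
Proof.
refine (@ProjResolution R L (fun i => 'rV[R]_(rk C i)) (fun i => rmul (dm C i))
  (lcomb e) _ _ _ _).
- by move=> n; exact: rV_projective.
- by case: h.
- by move=> v; case: h => _ h _; split=> [/h[u ->]|[u <-]]; [exists u|apply/h; exists u].
- by move=> n v; case: h => _ _ h; split=> [/h[u ->]|[u <-]]; [exists u|apply/h; exists u].
Defined.

Lemma fcons_exact n (C : fcx) (B : 'M[R]_(rk C 0, n)) :
  mexact (dm C 0) B -> exact_cx C -> exact_cx (fcons B).
Proof. by move=> hB hC [|i]; [exact: hB | exact: hC]. Qed.

Lemma ftail_exact C : exact_cx C -> exact_cx (ftail C).
Proof. by move=> h i; exact: h. Qed.

Definition coker p q (D : 'M[R]_(p, q)) : lmodType R :=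
  quo (submod_range (rmul D)).

Definition coker_gens p q (D : 'M[R]_(p, q)) : {ffun 'I_q -> coker D} :=
  [ffun i => quo_pi (submod_range (rmul D)) (delta_mx 0 i)].

Lemma coker_resolves p q (D : 'M[R]_(p, q)) (C : fcx) (B : 'M[R]_(rk C 0, p)) :
  mexact (dm C 0) B -> exact_cx C -> mexact B D ->
  @resolves (coker D) (fcons (C := fcons B) D) (coker_gens D).
Proof.
move=> hB hC hD.
have eq v : lcomb (coker_gens D) v = quo_pi (submod_range (rmul D)) v.
  by rewrite (lin_lcomb (quo_pi _)).
split=> [x|v|].
- by have [y <-] := quo_pi_surj x; exists y; rewrite eq.
- by rewrite eq quo_pi0; split=> [[u <-]|[u ->]]; exists u.
- by case=> [|[|i]]; [exact: hD | exact: hB | exact: hC].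
Qed.

Lemma coker_fin_gen p q (D : 'M[R]_(p, q)) : fin_gen (coker D).
Proof.
apply/fin_genP; exists q, (coker_gens D) => x; have [y <-] := quo_pi_surj x.
by exists y; rewrite [RHS]lin_lcomb.
Qed.

Section Minimal.
Variable m : R -> Prop.
Hypotheses (nR : noeth R^o) (hm : is_local m).

Definition in_mx p q (A : 'M[R]_(p, q)) : Prop := forall i j, m (A i j).

Definition min_cx (C : fcx) : Prop := forall i, in_mx (dm C i).

Lemma in_mxD p q (A B : 'M[R]_(p, q)) : in_mx A -> in_mx B -> in_mx (A + B).
Proof. by move=> hA hB i j; rewrite mxE; apply: idealD => //; exact: local_ideal. Qed.

Lemma in_mxMl p q r (A : 'M[R]_(p, q)) (B : 'M[R]_(q, r)) : in_mx B -> in_mx (A *m B).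
Proof.
move=> hB i j; rewrite mxE; apply: ideal_sum; first exact: local_ideal.
by move=> k _; apply: idealM; [exact: local_ideal | exact: hB].
Qed.

Lemma in_mxMr p q r (A : 'M[R]_(p, q)) (B : 'M[R]_(q, r)) : in_mx A -> in_mx (A *m B).
Proof.
move=> hA i j; rewrite mxE; apply: ideal_sum; first exact: local_ideal.
by move=> k _; apply: idealMl; [exact: local_ideal | exact: hA].
Qed.

Lemma in_mx_tr p q (A : 'M[R]_(p, q)) : in_mx A -> in_mx A^T.
Proof. by move=> hA i j; rewrite mxE. Qed.

Lemma in_mx1 n : in_mx (1%:M : 'M[R]_n) -> n = 0%N.
Proof.
case: n => // n /(_ ord0 ord0); rewrite mxE eqxx => h.
by case: hm => _ [].
Qed.

Lemma min_syzygy q (S : 'rV[R]_q -> Prop) : submod S ->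
  exists p (A : 'M[R]_(p, q)), (forall v, S v <-> exists u, v = u *m A) /\
    forall u : 'rV_p, u *m A = 0 -> in_mx u.
Proof.
move=> hS; have [n [w [hw wm]]] := min_gens hm (noeth_rV nR hS).
have e v : lcomb w v = v *m \matrix_i w i.
  by rewrite mulmx_sum_row; apply: eq_bigr => i _; rewrite rowK.
exists n, (\matrix_i w i); split=> [v|u].
  by rewrite hw; split=> [[u <-]|[u ->]]; exists u; rewrite e.
by rewrite -e => /wm h i j; rewrite ord1.
Qed.

Lemma min_res_sub q (S : 'rV[R]_q -> Prop) : submod S ->
  exists (C : fcx) (B : 'M[R]_(rk C 0, q)),
    [/\ forall v, S v <-> exists u, v = u *m B, mexact (dm C 0) B, exact_cx C & min_cx C].
Proof.
move=> hS.
(* A state is a rank with a bare predicate on row vectors, so that it can be iterated. The empty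
   matrix is a default for predicates that are no submodules, which [subst] rules out. *)
have genE (s : {q & 'rV[R]_q -> Prop}) : exists A : {p & 'M[R]_(p, projT1 s)},
    submod (projT2 s) -> (forall v, projT2 s v <-> exists u, v = u *m projT2 A) /\
    forall u : 'rV_(projT1 A), u *m projT2 A = 0 -> in_mx u.
  have [h|h] := pselect (submod (projT2 s)); last by exists (existT _ 0%N (0 : 'M_(0, projT1 s))).
  by have [p [A hA]] := min_syzygy h; exists (existT _ p A).
pose gen s := sval (cid (genE s)); have genP s := svalP (cid (genE s)).
pose nx (s : {q & 'rV[R]_q -> Prop}) : {q & 'rV[R]_q -> Prop} :=
  existT _ (projT1 (gen s)) (fun u : 'rV_(projT1 (gen s)) => u *m projT2 (gen s) = 0).
pose st i := iter i nx (existT _ q S).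
have subst i : submod (projT2 (st i)).
  by case: i => [|i] //=; exact: (submod_ker (rmul (projT2 (gen (st i))))).
pose C := Fcx (rk := fun i => projT1 (st i.+1)) (fun i => projT2 (gen (st i.+1))).
exists C, (projT2 (gen (st 0%N))); split.
- by have [] := genP _ (subst 0%N).
- by move=> v; have [h _] := genP _ (subst 1%N); apply: h.
- by move=> i v; have [h _] := genP _ (subst i.+2); apply: h.
(* The rows of a differential are relations among the minimal generators chosen one step earlier,
   hence have entries in [m]. *)
- move=> i j k; have [_ h2] := genP _ (subst i).
  have [h1 _] := genP _ (subst i.+1).
  have : projT2 (st i.+1) (row j (projT2 (gen (st i.+1)))).
    by apply/h1; exists (delta_mx 0 j); rewrite -rowE.
  by move=> /h2/(_ 0 k); rewrite mxE.
Qed.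

Lemma min_res (L : lmodType R) : fin_gen L ->
  exists (C : fcx) (e : {ffun 'I_(rk C 0) -> L}), resolves e /\ min_cx C.
Proof.
move=> hL; have [n [e [he em]]] := min_gens hm (noeth_fin_gen nR hL (submod_setT L)).
have [C [B [hB BC CC mC]]] := min_res_sub (submod_ker (lcomb e)).
exists (fcons B), e; split; last first.
  case=> [|i] j k; last exact: mC.
  have : lcomb e (row j B) = 0 by apply/hB; exists (delta_mx 0 j); rewrite -rowE.
  by move=> /em/(_ k); rewrite mxE.
split=> //; last exact: fcons_exact.
by move=> x; have [v <-] := (he x).1 I; exists v.
Qed.

End Minimal.

End Complexes.

(** * Independence of Tor and Ext of the resolution *)

Section Comparison.
Variable R : comNzRingType.
Implicit Types A B X L M N V W : lmodType R.

Definition mklin V W (f : V -> W) (h : linear f) : {linear V -> W} :=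
  HB.pack f (GRing.isLinear.Build R V W _ f h).

(** Projectivity lifts along surjections, while [d] need only reach the image of [g]. Chosen
    preimages are linear modulo [ker d], and the lift is taken along the surjection from [A] to
    [A / ker d]. *)
Lemma proj_lift X A B (d : {linear A -> B}) (g : {linear X -> B}) : projective X ->
  (forall x, exists a, d a = g x) -> exists h : {linear X -> A}, forall x, d (h x) = g x.
Proof.
move=> hX /choice[c hc]; have hK := submod_ker d.
have gl : linear (fun x => quo_pi hK (c x)).
  move=> a x y; rewrite -linearP; apply/eqP; rewrite -subr_eq0 -linearB; apply/eqP/quo_pi0.
  by rewrite linearB linearP !hc linearP subrr.
have [h hh] := hX _ _ (quo_pi hK) (mklin gl) (@quo_pi_surj _ _ _ hK).
exists h => x; move: (hh x) => /= /eqP; rewrite -subr_eq0 -linearB => /eqP/quo_pi0.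
by rewrite linearB hc => /eqP; rewrite subr_eq0 => /eqP.
Qed.

Lemma dep_choice (T : nat -> Type) (Q : forall n, T n -> T n.+1 -> Prop) :
  (forall n x, exists y, Q n x y) -> forall x0 : T 0%N,
  exists s : forall n, T n, s 0%N = x0 /\ forall n, Q n (s n) (s n.+1).
Proof.
move=> h x0; pose s := fix s n : T n :=
  if n is k.+1 then sval (cid (h k (s k))) else x0.
by exists s; split=> // n; exact: svalP (cid (h n (s n))).
Qed.

Lemma dd0 (M : lmodType R) (P : proj_resolution M) n x :
  pdiff P n (pdiff P n.+1 x) = 0.
Proof. by apply/pdiff_exact; exists x. Qed.

Lemma chain_lift M (P Q : proj_resolution M) :
  exists f : forall n, {linear pobj P n -> pobj Q n},
    (forall x, paug Q (f 0%N x) = paug P x) /\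
    forall n x, pdiff Q n (f n.+1 x) = f n (pdiff P n x).
Proof.
(* The invariant of the recursion: [f] sends boundaries to boundaries, which is what allows the next
   lift. *)
pose K n (f : {linear pobj P n -> pobj Q n}) :=
  forall x, exists a, pdiff Q n a = f (pdiff P n x).
have [f0 hf0] : exists f0 : {linear pobj P 0 -> pobj Q 0},
    forall x, paug Q (f0 x) = paug P x.
  apply: proj_lift; first exact: pobj_projective.
  by move=> x; exact: paug_surj.
have K0 : K 0%N f0.
  move=> x; apply/paug_exact; rewrite hf0; apply/paug_exact; by exists x.
have step n (f : {f | K n f}) : exists g : {g | K n.+1 g},
    forall x, pdiff Q n (sval g x) = sval f (pdiff P n x).
  case: f => f Kf /=.
  have [|g hg] := @proj_lift _ _ _ (pdiff Q n) (f \o pdiff P n) (@pobj_projective _ _ P n.+1).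
    exact: Kf.
  have Kg : K n.+1 g.
    by move=> x; apply/pdiff_exact; rewrite hg /= dd0 linear0.
  by exists (exist _ g Kg).
have [s [s0 hs]] := dep_choice step (exist _ f0 K0).
exists (fun n => sval (s n)); split=> [x|n x]; last exact: hs.
by rewrite s0.
Qed.

Lemma null_homotopy M (P : proj_resolution M) (u : forall n, {linear pobj P n -> pobj P n}) :
  (forall x, paug P (u 0%N x) = 0) ->
  (forall n x, pdiff P n (u n.+1 x) = u n (pdiff P n x)) ->
  exists h : forall n, {linear pobj P n -> pobj P n.+1},
    (forall x, u 0%N x = pdiff P 0 (h 0%N x)) /\
    forall n x, u n.+1 x = pdiff P n.+1 (h n.+1 x) + h n (pdiff P n x).
Proof.
move=> u0 hu.
pose K n (h : {linear pobj P n -> pobj P n.+1}) :=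
  forall x, pdiff P n (u n.+1 x - h (pdiff P n x)) = 0.
have [h0 hh0] : exists h0 : {linear pobj P 0 -> pobj P 1}, forall x, pdiff P 0 (h0 x) = u 0%N x.
  apply: proj_lift; first exact: pobj_projective.
  by move=> x; apply/paug_exact; exact: u0.
have K0 : K 0%N h0 by move=> x; rewrite linearB hu hh0 subrr.
have step n (h : {h | K n h}) : exists g : {g | K n.+1 g},
    forall x, u n.+1 x = pdiff P n.+1 (sval g x) + sval h (pdiff P n x).
  case: h => h Kh /=.
  have [|g hg] := @proj_lift _ _ _ (pdiff P n.+1) (u n.+1 \- (h \o pdiff P n))
    (@pobj_projective _ _ P n.+1).
    by move=> x; apply/pdiff_exact; exact: Kh.
  have Kg : K n.+1 g by move=> x; rewrite linearB hu hg /= dd0 linear0 subr0 subrr.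
  by exists (exist _ g Kg) => x /=; rewrite hg /= subrK.
have [s [s0 hs]] := dep_choice step (exist _ h0 K0).
exists (fun n => sval (s n)); split=> [x|n x]; last exact: hs.
by rewrite s0 /= hh0.
Qed.

(** [P] is a homotopy retract of [Q]; this one-sided statement carries acyclicity from [Q] to [P],
    and the roles can be exchanged. *)
Lemma resolution_retract M (P Q : proj_resolution M) :
  exists (f : forall n, {linear pobj P n -> pobj Q n})
    (g : forall n, {linear pobj Q n -> pobj P n})
    (h : forall n, {linear pobj P n -> pobj P n.+1}),
  [/\ forall n x, pdiff Q n (f n.+1 x) = f n (pdiff P n x),
      forall n x, pdiff P n (g n.+1 x) = g n (pdiff Q n x),
      forall x, g 0%N (f 0%N x) = x + pdiff P 0 (h 0%N x) &
      forall n x, g n.+1 (f n.+1 x) = x + (pdiff P n.+1 (h n.+1 x) + h n (pdiff P n x))].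
Proof.
have [f [f0 hf]] := chain_lift P Q; have [g [g0 hg]] := chain_lift Q P.
have [||h [h0 hh]] := @null_homotopy M P (fun n => (g n \o f n) \- idfun).
- by move=> x /=; rewrite linearB g0 f0 subrr.
- by move=> n x /=; rewrite linearB hg hf.
exists f, g, h; split=> // [x|n x]; first by rewrite -h0 /= addrC subrK.
by rewrite -hh /= addrC subrK.
Qed.

Lemma Hom_acyclic_transfer M N (P Q : proj_resolution M) n :
  Hom_acyclic_at N P n -> Hom_acyclic_at N Q n.
Proof.
have [f [g [h [hf hg gf0 gfS]]]] := resolution_retract Q P.
case: n => [|n] acyc phi dphi.
  have /(_ (phi \o g 0%N)) := acyc.
  move=> /(_ _)/= hz x; have : phi (g 0%N (f 0%N x)) = 0.
    by apply: hz => y; rewrite -hg dphi.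
  by rewrite gf0 linearD dphi addr0.
have [|psi hpsi] := acyc (phi \o g n.+1); first by move=> x /=; rewrite -hg dphi.
exists ((psi \o f n) \- (phi \o h n)) => x /=.
rewrite -hf -hpsi /= gfS !linearD dphi add0r /=.
by rewrite addrK.
Qed.

Definition resolution_bounded M (d : int) : Prop :=
  exists P : proj_resolution M, forall i : nat, (d < i%:Z) -> zero_module (pobj P i).

End Comparison.

(** * Tensor products, and Tor and Ext in terms of matrices *)

Section TensorTransfer.
Variable R : comNzRingType.
Implicit Types A B C L N : lmodType R.

Lemma tensor_ext A B (T : lmodType R) C (t : A -> B -> T) (g g' : {linear T -> C}) : is_tensor t ->
  (forall a b, g (t a b) = g' (t a b)) -> g =1 g'.
Proof.
move=> [[t1 t2] ht] h; have [|_] := ht C (fun a b => g (t a b)); last by apply=> // a b.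
by split=> [a|b] r x y; rewrite /= ?t1 ?t2 linearP.
Qed.

Lemma tensor_pairD A B (T : lmodType R) (t : A -> B -> T) x a b : is_tensor t ->
  t x (a + b) = t x a + t x b.
Proof. by move=> [[t1 _] _]; exact: (linearD (mklin (t1 x))). Qed.

Lemma tensor_pair0 A B (T : lmodType R) (t : A -> B -> T) x : is_tensor t -> t x 0 = 0.
Proof. by move=> [[t1 _] _]; exact: (linear0 (mklin (t1 x))). Qed.

Lemma tensor_map N A B (T U : lmodType R) (t : N -> A -> T) (u : N -> B -> U) (f : {linear A -> B}) :
  is_tensor t -> is_tensor u ->
  exists g : {linear T -> U}, forall x a, g (t x a) = u x (f a).
Proof.
move=> [_ ht] [[u1 u2] _]; have [|h _] := ht U (fun x a => u x (f a)); last exact: h.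
by split=> [a|b] r x y; [rewrite /= linearP; exact: u1 | exact: (u2 (f b) r x y)].
Qed.

(** The retraction survives tensoring with [N]. The tensor products are arbitrary, so its identities
    are checked on pure tensors and extended by the universal property. *)
Lemma tensor_exact_transfer L N (P Q : proj_resolution L)
    (T : tensor_complex N P) (U : tensor_complex N Q) n :
  exact_pair (tdiff T n.+1) (tdiff T n) -> exact_pair (tdiff U n.+1) (tdiff U n).
Proof.
move=> ex; have [f [g [h [hf hg _ gfS]]]] := resolution_retract Q P.
have tT k := @tpair_tensor _ _ _ _ T k; have tU k := @tpair_tensor _ _ _ _ U k.
have [F1 hF1] := tensor_map (f n.+1) (tU n.+1) (tT n.+1).
have [F0 hF0] := tensor_map (f n) (tU n) (tT n).
have [G2 hG2] := tensor_map (g n.+2) (tT n.+2) (tU n.+2).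
have [G1 hG1] := tensor_map (g n.+1) (tT n.+1) (tU n.+1).
have [H1 hH1] := tensor_map (h n.+1) (tU n.+1) (tU n.+2).
have [H0 hH0] := tensor_map (h n) (tU n) (tU n.+1).
have e1 : tdiff T n \o F1 =1 F0 \o tdiff U n.
  by apply: (tensor_ext (tU n.+1)) => a b /=; rewrite hF1 !tdiffE hF0 hf.
have e2 : tdiff U n.+1 \o G2 =1 G1 \o tdiff T n.+1.
  by apply: (tensor_ext (tT n.+2)) => a b /=; rewrite hG2 !tdiffE hG1 hg.
have e3 : G1 \o F1 =1 idfun \+ ((tdiff U n.+1 \o H1) \+ (H0 \o tdiff U n)).
  apply: (tensor_ext (tU n.+1)) => a b /=; rewrite hF1 hG1 hH1 !tdiffE hH0 gfS.
  by rewrite !(tensor_pairD _ _ _ (tU n.+1)).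
have dd : tdiff U n \o tdiff U n.+1 =1 \0.
  by apply: (tensor_ext (tU n.+2)) => a b /=; rewrite !tdiffE dd0 (tensor_pair0 _ (tU n)).
move=> y; split=> [dy|[x <-]]; last exact: dd.
have /ex[z hz] : tdiff T n (F1 y) = 0 by have /= -> := e1 y; rewrite dy linear0.
exists (G2 z - H1 y); rewrite linearB; have /= -> := e2 z; rewrite hz.
by have /= -> := e3 y; rewrite dy linear0 addr0 addrK.
Qed.

Section Explicit.
Variables (L N : lmodType R) (C : fcx R) (e : {ffun 'I_(rk C 0) -> L}).
Hypothesis he : resolves e.

(** Realizes N (x) R^n as N^n. *)
Definition tup_pair n (x : N) (v : 'rV[R]_n) : {ffun 'I_n -> N} := [ffun i => v 0 i *: x].

Lemma tup_pair_tensor n : is_tensor (@tup_pair n).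
Proof.
split.
  split=> [a|v] r x y; apply/ffunP => i; rewrite !ffunE.
    by rewrite !mxE scalerDl scalerA.
  by rewrite scalerDr !scalerA mulrC.
move=> D f [f1 f2]; have f1D a : linear (f a) by exact: f1.
have gl : linear (fun w : {ffun 'I_n -> N} => \sum_i f (w i) (delta_mx 0 i)).
  move=> r x y; rewrite scaler_sumr -big_split /=; apply: eq_bigr => i _.
  by rewrite !ffunE; exact: f2.
split.
  exists (mklin gl) => a v; rewrite /= -[f a v]/(mklin (f1 a) v) [RHS]lin_lcomb.
  apply: eq_bigr => i _; rewrite !ffunE /=.
  by have := linearZZ (mklin (f2 (delta_mx 0 i))) (v 0 i) a.
move=> g g' hg hg' w.
have -> : w = \sum_i tup_pair (w i) (delta_mx 0 i).
  apply/ffunP => j; rewrite sum_ffunE (bigD1 j) //= ffunE mxE !eqxx scale1r big1 ?addr0 //.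
  by move=> i ij; rewrite ffunE mxE eqxx eq_sym (negPf ij) scale0r.
by rewrite !linear_sum; apply: eq_bigr => i _; rewrite hg hg'.
Qed.

Definition tup_complex : tensor_complex N (fres_proj he).
Proof.
refine (@TensorComplex R N L (fres_proj he) (fun n => {ffun 'I_(rk C n) -> N} : lmodType R)
  (fun n => tmap (dm C n)) (fun n => @tup_pair (rk C n)) _ _).
- by move=> n; exact: tup_pair_tensor.
- move=> n x v; apply/ffunP => j; rewrite !ffunE /= mxE scaler_suml.
  by apply: eq_bigr => i _; rewrite ffunE scalerA mulrC.
Defined.

(** Only the substantial half of exactness; the other inclusion is [A *m B = 0], which does not
    involve [N]. *)
Definition texact p q r (A : 'M[R]_(p, q)) (B : 'M[R]_(q, r)) : Prop :=
  forall w : {ffun 'I_q -> N}, tmap B w = 0 -> exists u, w = tmap A u.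

Lemma Tor_texact n : Tor_vanishes n.+1 N L <-> texact (dm C n.+1) (dm C n).
Proof.
split=> [[P [T ex]] w hw|ex].
  by have [/(_ hw)[u <-] _] := @tensor_exact_transfer _ _ _ _ T tup_complex _ ex w; exists u.
exists (fres_proj he), tup_complex => w; split=> [/ex[u ->]|[u <-]]; first by exists u.
rewrite /= -tmap_mul mexact_mul0 ?tmap0 //.
by case: he => _ _; exact.
Qed.

Lemma lcomb_surj n (phi : {linear 'rV[R]_n -> N}) : exists w, phi =1 lcomb w.
Proof. by exists [ffun i => phi (delta_mx 0 i)] => v; rewrite lin_lcomb. Qed.

(** A homomorphism from R^p to [N] is a tuple, and by [lcomb_mul] precomposing it with a matrix is
    the action of the transpose. *)
Lemma Ext_texact n : Ext_vanishes n.+1 L N <-> texact (dm C n)^T (dm C n.+1)^T.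
Proof.
split=> [[P /(@Hom_acyclic_transfer _ _ _ _ (fres_proj he)) ex] w hw|ex].
  have /= [|psi hpsi] := ex (lcomb w); first by move=> v /=; rewrite lcomb_mul hw /lcomb big1 // => i _; rewrite ffunE scaler0.
  have [u hu] := lcomb_surj psi; exists u; apply: lcomb_inj => v.
  by rewrite hpsi hu /= lcomb_mul.
exists (fres_proj he) => phi; have [w hw] := lcomb_surj phi => dphi.
have [|u hu] := ex w.
  by apply/ffunP => i; rewrite -lcomb_delta -lcomb_mul -hw ffunE; exact: dphi.
by exists (lcomb u) => v; rewrite hw hu -lcomb_mul.
Qed.

Lemma Ext0_tmap : Ext_vanishes 0 L N <->
  forall w : {ffun 'I_(rk C 0) -> N}, tmap (dm C 0)^T w = 0 -> w = 0.
Proof.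
split=> [[P /(@Hom_acyclic_transfer _ _ _ _ (fres_proj he)) ex] w hw|ex].
  have /= h := ex (lcomb w); apply/ffunP => i; rewrite -lcomb_delta ffunE; apply: h => v /=.
  by rewrite lcomb_mul hw /lcomb big1 // => j _; rewrite ffunE scaler0.
exists (fres_proj he) => phi; have [w hw] := lcomb_surj phi => dphi v.
rewrite hw (ex w) /lcomb ?big1 // => [i _|]; first by rewrite ffunE scaler0.
by apply/ffunP => i; rewrite -lcomb_delta -lcomb_mul -hw ffunE; exact: dphi.
Qed.

End Explicit.

End TensorTransfer.

(** * Krull's principal ideal theorem *)

Section Primes.
Variable R : comNzRingType.
Hypothesis nR : noeth R^o.
Implicit Types V N : lmodType R.
Implicit Types p q m I J : R -> Prop.

(** The annihilator of the class of [z] in V/U, without forming the quotient. *)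
Definition ann V (U : V -> Prop) (z : V) (r : R) : Prop := U (r *: z).

Lemma ann_ideal V (U : V -> Prop) z : submod U -> is_ideal (ann U z).
Proof.
move=> hU; split=> [|a x y hx hy]; first by rewrite /ann scale0r; exact: hU.1.
by rewrite /ann scalerDl -scalerA; exact: hU.2.
Qed.

(* The associated primes contained in [p] are those of the localization at [p]. *)
Lemma assoc_prime V (U : V -> Prop) p : submod U -> is_prime p ->
  (exists z, forall r, ann U z r -> p r) ->
  exists z, (forall r, ann U z r -> p r) /\ is_prime (ann U z).
Proof.
move=> hU hp [z0 hz0].
pose P (S : R^o -> Prop) := exists2 z, (forall r, ann U z r -> p r) & S = ann U z.
have [||_ [z hz ->] zmax] := @noeth_max R R^o P nR.
- by move=> _ [z _ ->]; exact: (ann_ideal z hU).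
- by exists (ann U z0); exists z0.
have max' b : ~ p b -> forall r, ann U (b *: z) r -> ann U z r.
  move=> pb; apply: (zmax (ann U (b *: z))) => [|r zr].
    exists (b *: z) => // r; rewrite /ann scalerA => /hz.
    by case: hp => _ _ h /h[].
  by rewrite /ann scalerA mulrC -scalerA; exact: submodZ.
exists z; split=> //; split; first exact: ann_ideal.
  by move=> /hz; case: hp.
move=> r s rs; apply: contrapT => /not_orP[nr ns].
(* Either [s *: z] competes with [z] for maximality and [r] kills [z], or some [b] outside [p] kills
   [s *: z], so [s] kills [b *: z] and by [max'] also [z]. *)
have [h|/existsNP[b /not_implyP[hb pb]]] := pselect (forall b, ann U (s *: z) b -> p b).
  apply: nr; apply: (zmax (ann U (s *: z))).
  - by exists (s *: z).
  - by move=> a za; rewrite /ann scalerA mulrC -scalerA; exact: submodZ.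
  - by rewrite /ann scalerA.
apply: ns; apply: (max' b pb); rewrite /ann scalerA mulrC -scalerA.
by move: hb; rewrite /ann.
Qed.

(** Each step adjoins one [z] whose annihilator modulo the previous ideal is a prime P, so the layer
    it adds is isomorphic to R/P. *)
Inductive prime_filt J : (R -> Prop) -> Prop :=
| PrimeFilt0 : prime_filt J J
| PrimeFiltS I z : prime_filt J I -> is_prime (ann (V := R^o) I z) ->
    prime_filt J (fun a => exists c, I (a - c * z)).

Lemma prime_filt_sub J I x : prime_filt J I -> J x -> I x.
Proof.
move=> h Jx; elim: h => // {}I z _ Ix _; exists 0.
by rewrite mul0r subr0.
Qed.

Lemma prime_filt_ideal J I : is_ideal J -> prime_filt J I -> is_ideal I.
Proof.
move=> hJ; elim=> // {}I z _ hI _; split; first by exists 0; rewrite mul0r subr0; exact: hI.1.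
move=> a x y [c hc] [d hd]; exists (a * c + d).
suff -> : a * x + y - (a * c + d) * z = a * (x - c * z) + (y - d * z) by exact: hI.2.
by ring.
Qed.

(** A maximal ideal reached from [J] is the unit ideal, for otherwise an associated prime of the
    quotient would permit one more step. *)
Lemma prime_filtration m J : is_local m -> is_ideal J -> exists2 I, prime_filt J I & I 1.
Proof.
move=> hm hJ; have [||I hI Imax] := @noeth_max R R^o (prime_filt J) nR.
- by move=> I; exact: prime_filt_ideal.
- by exists J; exact: PrimeFilt0.
exists I => //; apply: contrapT => nI1; have idI := prime_filt_ideal hJ hI.
have [|z [_ pz]] := @assoc_prime R^o I m idI (local_prime hm).
  exists 1 => r; rewrite /ann => h; apply: (local_sup hm idI nI1).
  by rewrite -[r]mulr1.
case: (pz) => _ h _; apply: h; rewrite /ann scale1r.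
apply: (Imax _ (PrimeFiltS hI pz)) => [x Ix|]; first by exists 0; rewrite mul0r subr0.
by exists 1; rewrite mul1r subrr; exact: idI.1.
Qed.

(* Localized at a prime minimal over [J], the ring [R / J] is Artinian. *)
Lemma local_dcc p J T (I : nat -> R -> Prop) : is_prime p -> is_ideal J -> prime_filt J T ->
  (forall P, is_prime P -> (forall x, J x -> P x) -> (forall x, P x -> p x) ->
     forall x, p x -> P x) ->
  (forall n, is_ideal (I n)) -> (forall n x, J x -> I n x) ->
  (forall n x, I n.+1 x -> I n x) ->
  exists n0, forall n, (n0 <= n)%N -> forall a, I n a -> T a ->
    exists2 t, ~ p t & I n.+1 (t * a).
Proof.
move=> hp hJ hT pmin hI JI Idec; elim: hT => [|T' z hT' [n0 IH] Pz].
  by exists 0%N => n _ a _ Ja; exists 1; [case: hp | apply: JI; rewrite mul1r].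
have hT := prime_filt_ideal hJ hT'.
(* If the annihilator of [z] modulo [T'] is not inside [p], the layer vanishes locally: some [s]
   outside [p] moves it into [T']. Otherwise minimality makes the annihilator equal to [p], and the
   layer is locally one-dimensional over the residue field of [p]. *)
have [sub|/existsNP[s /not_implyP[hs ps]]] := pselect (forall r, ann (V := R^o) T' z r -> p r);
  last first.
  exists n0 => n n0n a Ia [c hc]; have [||t pt It] := IH n n0n (s * a).
  - exact: (idealM s (hI n)).
  - rewrite -(subrK (s * (c * z)) (s * a)) -mulrBr; apply: (idealD hT).
      exact: (idealM s hT).
    by rewrite mulrCA; exact: (idealM c hT).
  - by exists (t * s); [exact: primeM | rewrite -mulrA].
have {}pmin r : p r -> T' (r * z).
  apply: (pmin (ann (V := R^o) T' z)) => // x /(prime_filt_sub hT') Tx.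
  by rewrite /ann /GRing.scale /= mulrC; exact: idealM.
(* [Q n]: locally at [p], [I n] meets this layer. If this holds for all [n], an element of [I n.+1]
   cancels the [z]-part of any [a]; if it fails at [n1], from there on [a] already lies in [T']. *)
pose Q n := exists a c, [/\ I n a, T' (a - c * z) & ~ p c].
have [allQ|/existsNP[n1 nQ]] := pselect (forall n, Q n).
  exists n0 => n n0n a Ia [c hc]; have [b [d [Ib hd pd]]] := allQ n.+1.
  have [||t pt It] := IH n n0n (d * a - c * b).
  - by apply: (idealB (hI n)); apply: (idealM _ (hI n)) => //; exact: Idec.
  - rewrite (_ : d * a - c * b = d * (a - c * z) - c * (b - d * z)); last by ring.
    by apply: (idealB hT); exact: (idealM _ hT).
  - exists (t * d); first exact: primeM.
    rewrite (_ : t * d * a = t * (d * a - c * b) + t * c * b); last by ring.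
    by apply: (idealD (hI n.+1)) => //; exact: (idealM _ (hI n.+1)).
have Idec' n k x : I (k + n)%N x -> I n x by elim: k => // k h /Idec.
exists (maxn n0 n1) => n; rewrite geq_max => /andP[n0n n1n] a Ia [c hc].
apply: IH => //; rewrite -(subrK (c * z) a); apply: (idealD hT) => //.
apply: pmin; apply: contrapT => pc; apply: nQ; exists a, c; split=> //.
by apply: (Idec' _ (n - n1)%N); rewrite subnK.
Qed.

Definition strict_sub p q : Prop := (forall x, p x -> q x) /\ exists2 x, q x & ~ p x.

Definition adjoin q (x : R) (a : R) : Prop := exists c, q (a - c * x).

Lemma adjoin_ideal q x : is_ideal q -> is_ideal (adjoin q x).
Proof.
move=> hq; split; first by exists 0; rewrite mul0r subr0; exact: hq.1.
move=> a u v [c hc] [d hd]; exists (a * c + d).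
suff -> : a * u + v - (a * c + d) * x = a * (u - c * x) + (v - d * x) by exact: hq.2.
by ring.
Qed.

(* Krull's principal ideal theorem: with [q < q' < p] and [x] in [p], the prime
   [p] is not minimal over [q + (x)]. *)
Lemma krull_pit m q (q' : R -> Prop) p x : is_local m -> is_prime q -> is_prime q' -> is_prime p ->
  strict_sub q q' -> strict_sub q' p -> p x -> ~ q' x ->
  exists P, [/\ is_prime P, forall y, q y -> P y, P x & strict_sub P p].
Proof.
move=> hm hq hq' hp [qq' [y q'y nqy]] [q'p _] px nq'x; apply: contrapT => no.
have [iq _ qM] := hq; have [iq' q'1 q'M] := hq'; have [ip p1 pM] := hp.
pose J := adjoin q x; have hJ : is_ideal J by exact: adjoin_ideal.
have qJ a : q a -> J a by exists 0; rewrite mul0r subr0.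
(* [Y n] is the contraction of the ideal generated by [q] and [y ^+ n] in the
   localization at [q']. *)
pose Y n a := exists2 s, ~ q' s & exists r, q (s * a - r * y ^+ n).
have hY n : is_ideal (Y n).
  split; first by exists 1 => //; exists 0; rewrite mul0r mulr0 subrr; exact: iq.1.
  move=> a u v [s ns [r hr]] [t nt [w hw]]; exists (s * t); first exact: primeM.
  exists (a * t * r + s * w).
  suff -> : s * t * (a * u + v) - (a * t * r + s * w) * y ^+ n =
    (a * t) * (s * u - r * y ^+ n) + s * (t * v - w * y ^+ n) by apply: (idealD iq); exact: (idealM _ iq).
  by ring.
have qY n a : q a -> Y n a.
  by move=> qa; exists 1 => //; exists 0; rewrite mul0r subr0 mul1r.
have Ydec n a : Y n.+1 a -> Y n a.
  by move=> [s ns [r hr]]; exists s => //; exists (r * y); rewrite -mulrA -exprS.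
pose I n a := exists c, Y n (a - c * x).
have hI n : is_ideal (I n) by exact: (adjoin_ideal x (hY n)).
have [T hT T1] := prime_filtration hm hJ; have hT' := prime_filt_ideal hJ hT.
have [|||n dcc] := @local_dcc p J T I hp hJ hT _ hI.
- move=> P hP JP Pp w pw; apply: contrapT => nPw; apply: no; exists P; split=> //.
  + by move=> u qu; apply: JP; exact: qJ.
  + by apply: JP; exists 1; rewrite mul1r subrr; exact: iq.1.
  + by split=> //; exists w.
- by move=> n a [c hc]; exists c; exact: qY.
- by move=> n a [c hc]; exists c; exact: Ydec.
(* Since [I n] is [Y n] plus multiples of [x], stability makes [t * a] a multiple [c * x] modulo
   [Y n.+1]. Then [c * x] is in [Y n], and so is [c] because [x] is outside [q']. *)
have {}dcc a : Y n a -> exists2 t, ~ p t & exists2 c, Y n c & Y n.+1 (t * a - c * x).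
  move=> Ya; have [||t pt [c hc]] := dcc n (leqnn n) a.
  - by exists 0; rewrite mul0r subr0.
  - by rewrite -[a]mulr1; exact: (idealM _ hT').
  exists t => //; exists c => //.
  have : Y n (c * x).
    rewrite -[c * x](subKr (t * a)); apply: (idealB (hY n)); last exact: Ydec.
    exact: (idealM _ (hY n)).
  case=> s ns [r hr]; exists (s * x); first exact: primeM.
  by exists r; rewrite -mulrA [x * c]mulrC.
have [s hs] := nR (hY n).
(* Locally at [p], [Y n] lies in [x] times itself plus [Y n.+1], so Nakayama with [x] in [p] absorbs
   it into [Y n.+1]. *)
have [t nt] : exists2 t, ~ p t & Y n.+1 (t * y ^+ n).
  apply: (@nakayama_local R R^o p (Y n.+1) s ip p1 pM (hY n.+1) _ (y ^+ n)).
    move=> a /span_mem/hs/dcc[t pt [c /hs/spanP[d hd] Yc]]; exists t => //.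
    exists (fun i => x * d i); first by move=> i; rewrite mulrC; exact: (idealM _ ip).
    suff -> : \sum_(i < size s) (x * d i) *: s`_i = c * x by [].
    rewrite hd mulr_suml; apply: eq_bigr => i _.
    rewrite /GRing.scale /=. ring.
  by apply/hs; exists 1 => //; exists 1; rewrite mul1r subrr; exact: iq.1.
(* Now [(u * t - r * y) * y ^+ n] is in [q] and [y] is not, so [u * t] is in [q'], although neither
   factor is. *)
case=> u nu [r]; rewrite mulrA exprS mulrA -mulrBl => /qM[h|/(prime_exp hq) //].
have : q' (u * t) by rewrite -(subrK (r * y) (u * t)); apply: (idealD iq'); [exact: qq' | exact: (idealM _ iq')].
by case/q'M => // /q'p.
Qed.

End Primes.

(** * Dimension and depth *)

Section Dimension.
Variable R : comNzRingType.
Hypothesis nR : noeth R^o.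
Variable m : R -> Prop.
Hypothesis hm : is_local m.
Implicit Types p q I J : R -> Prop.

Inductive pchain : nat -> (R -> Prop) -> (R -> Prop) -> Prop :=
| PChain0 p : is_prime p -> pchain 0 p p
| PChainS n p q r : pchain n p q -> is_prime r -> strict_sub q r -> pchain n.+1 p r.

Lemma pchain_top n p q : pchain n p q -> is_prime q.
Proof. by case. Qed.

Lemma pchain_bot n p q : pchain n p q -> is_prime p.
Proof. by elim. Qed.

Lemma pchain_cons n p q r : is_prime p -> strict_sub p q -> pchain n q r -> pchain n.+1 p r.
Proof.
move=> hp pq h; elim: h p hp pq => {n q r} [q hq|n q r s _ IH hs rs] p hp pq.
  exact: PChainS (PChain0 hp) hq pq.
by apply: PChainS hs rs; exact: IH.
Qed.

Lemma pchain_sub n p q x : pchain n p q -> p x -> q x.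
Proof. by move=> h; elim: h => // {}n {}p {}q r _ IH _ [qr _] /IH/qr. Qed.

(* [krull_pit] replaces the members of the chain one by one, from the top down. *)
Lemma pchain_move n p q x : pchain n.+1 p q -> q x ->
  exists2 p', pchain n p' q & p' x /\ forall y, p y -> p' y.
Proof.
elim: n q => [|n IH] q h qx.
  inversion h as [|k p1 q1 r1 h0 hq sub]; subst; inversion h0; subst.
  by exists q; [exact: PChain0 | split=> // y; exact: sub.1].
inversion h as [|k p1 b r1 hb hq sub]; subst.
have [bx|nbx] := pselect (b x).
  have [p' h' hp'] := IH b hb bx; exists p' => //; exact: PChainS h' hq sub.
inversion hb as [|k p1 b0 r1 hb0 pb sub0]; subst.
have [P [hP bP Px sP]] := krull_pit nR hm (pchain_top hb0) pb hq sub0 sub qx nbx.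
have nb0x : ~ b0 x by move=> /(sub0.1).
have [|p' h' hp'] := IH P _ Px; first by apply: PChainS hb0 hP _; split=> //; exists x.
by exists p' => //; exact: PChainS h' hq sP.
Qed.

(** Each generator is absorbed into the bottom prime at the cost of one step, by [pchain_move]; with
    none left, the bottom prime contains [m] and the chain has length 0. Extending the chain by [m]
    first only lengthens it. *)
Lemma pchain_bound (s : seq R) n p q : pchain n p q -> (forall x, x \in s -> m x) ->
  (forall x, m x -> exists2 y, p y & span (V := R^o) s (x - y)) -> (n <= size s)%N.
Proof.
wlog qm : n p q / forall x, m x -> q x => [hw|].
  move=> h sm hs; case: n => [|n] // in h *.
  have [mq|/existsNP[x /not_implyP[mx nqx]]] := pselect (forall x, m x -> q x); first exact: hw h sm hs.
  have [iq q1 _] := pchain_top h.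
  have h2 : pchain n.+2 p m.
    apply: PChainS h (local_prime hm) _; split; last by exists x.
    exact: (local_sup hm iq q1).
  by apply: ltnW; exact: (hw _ p m).
elim: s n p q qm => [|x s IH] n p q qm h sm hs.
  have mp y : m y -> p y by move=> /hs[z pz /= /eqP]; rewrite subr_eq0 => /eqP->.
  case: n h => // n h; inversion h as [|k p1 q1 r1 h1 hr [_ [y qy nqy]]]; subst.
  case: nqy; apply: (pchain_sub h1); apply: mp; have [iq q1' _] := hr.
  exact: (local_sup hm iq q1').
case: n h => // n h.
have [|p' h' [p'x pp']] := pchain_move h (x := x).
  by apply: qm; apply: sm; rewrite mem_head.
rewrite ltnS; apply: (IH n p' q) => // [y ys|y my]; first by apply: sm; rewrite inE ys orbT.
have [z pz [c hc]] := hs y my; have [ip _ _] := pchain_bot h'.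
exists (z + c * x); last by rewrite opprD addrA.
by apply: (idealD ip); [exact: pp' | exact: (idealM _ ip)].
Qed.

Lemma pchain_seq n p q : pchain n p q -> exists P : nat -> {pred R},
  prime_chain n P /\ forall x, x \in P n <-> q x.
Proof.
pose bp (r : R -> Prop) : {pred R} := [pred x | `[<r x>]].
have prP (r : R -> Prop) : is_prime r -> prime_ideal (bp r).
  move=> [[r0 rI] r1 rM]; split.
    split; rewrite ?inE //; first by apply/negP; rewrite inE.
    by move=> a x y; rewrite !inE; exact: rI.
  by move=> x y; rewrite inE => /rM[h|h]; apply/orP; [left|right]; rewrite inE.
elim=> {n p q} [p hp|n p q r _ [P [[hP1 hP2] Pq]] hr [qr [x rx nqx]]].
  by exists (fun _ => bp p); split=> [|x]; rewrite ?inE //; split=> // i _; exact: prP.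
exists (fun i => if (i <= n)%N then P i else bp r); split; last first.
  by move=> y; rewrite ltnn inE.
split=> i.
  by case: (leqP i n) => [i_n _|_ _]; [exact: hP1 | exact: prP].
rewrite ltnS => i_n; rewrite i_n; case: (ltnP i n) => [i_n'|n_i]; first exact: hP2.
have -> : i = n by apply/eqP; rewrite eqn_leq i_n.
split=> [y /Pq/qr|]; first by rewrite inE.
by exists x; rewrite ?inE //; apply/negP => /Pq.
Qed.

Lemma prime_chain_pchain n (P : nat -> {pred R}) : prime_chain n P ->
  pchain n (fun x => x \in P 0%N) (fun x => x \in P n).
Proof.
have prP (r : {pred R}) : prime_ideal r -> is_prime (fun x => x \in r).
  move=> [[r0 r1 rI] rM]; split=> //; first exact/negP.
  by move=> x y /rM/orP.
move=> [hP1 hP2]; have h i : (i <= n)%N -> pchain i (fun x => x \in P 0%N) (fun x => x \in P i).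
  elim: i => [|i IH] i_n; first exact/PChain0/prP/hP1.
  apply: PChainS (IH (ltnW i_n)) (prP _ (hP1 _ i_n)) _.
  by have [sub [x x1 x2]] := hP2 i i_n; split=> //; exists x => //; exact/negP.
exact: h.
Qed.

End Dimension.

(** * Regular sequences, prime avoidance and zero divisors *)

Section RegularSequences.
Variable R : comNzRingType.
Hypothesis nR : noeth R^o.
Variable m : R -> Prop.
Hypothesis hm : is_local m.
Implicit Types V N : lmodType R.

Fixpoint smul N (s : seq R) (v : N) : Prop :=
  if s is x :: t then exists w : N, smul t (v - x *: w) else v = 0.

Lemma in_smulP N (s : seq R) (v : N) : in_smul s v <-> smul s v.
Proof.
rewrite /in_smul; elim: s v => [|x t IH] v /=.
  by split=> [[w ->]|->]; [|exists (fun _ => 0)]; rewrite big_ord0.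
split=> [[w ->]|[w /IH[u e]]].
  by exists (w ord0); apply/IH; exists (fun i => w (lift ord0 i)); rewrite big_ord_recl /= addrC addKr.
exists (fun i => if unlift ord0 i is Some j then u j else w).
rewrite big_ord_recl unlift_none /= -[v](subrK (x *: w)) e addrC.
by congr (_ + _); apply: eq_bigr => i _; rewrite liftK.
Qed.

Lemma smul_submod N (s : seq R) : submod (@smul N s).
Proof.
elim: s => [|x t IH] /=; first by split=> // a u v -> ->; rewrite scaler0 addr0.
split=> [|a u v [y hy] [z hz]]; first by exists 0; rewrite scaler0 subr0; exact: IH.1.
exists (a *: y + z).
suff -> : a *: u + v - x *: (a *: y + z) = a *: (u - x *: y) + (v - x *: z) by exact: IH.2.
by rewrite scalerDr scalerBr opprD addrACA !scalerA mulrC.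
Qed.

Lemma smul_rcons N (s : seq R) x (v : N) : smul (rcons s x) v <-> exists w, smul s (v - x *: w).
Proof.
elim: s v => [|y t IH] v //=.
split=> [[w /IH[u h]]|[w [u h]]]; first by exists u, w; rewrite addrAC.
by exists u; apply/IH; exists w; rewrite addrAC.
Qed.

(** From the last element to the first: the current prime contains the annihilator of some [z]
    modulo the first [j.+1] elements, hence contains the element at [j]. An associated prime of [N]
    modulo the first [j] elements lies below it and omits that element by regularity. *)
Lemma regular_seq_pchain N (s : seq R) : fin_gen N ->
  (forall x, x \in s -> m x) -> regular_seq N s -> exists p, pchain (size s) p m.
Proof.
move=> fN sm [reg [v nv]].
suff h i : (i <= size s)%N -> exists p,
    (exists z : N, forall r, ann (smul (take (size s - i) s)) z r -> p r) /\ pchain i p m.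
  by have [p [_ hp]] := h _ (leqnn _); exists p.
elim: i => [|i IH] i_s.
  exists m; split; last exact/PChain0/local_prime.
  exists v => r; rewrite subn0 take_size => hr.
  apply: (local_sup hm (ann_ideal v (@smul_submod N s)) _ hr) => h.
  by apply: nv; apply/in_smulP; rewrite -[v]scale1r.
have [p [[z hz] hp]] := IH (ltnW i_s).
set j := (size s - i.+1)%N; have js : (j < size s)%N by rewrite /j ltn_subrL /=; exact: leq_ltn_trans i_s.
have ej : (size s - i)%N = j.+1 by rewrite /j subnSK.
have tk : take j.+1 s = rcons (take j s) s`_j by rewrite -take_nth.
have pj : p s`_j.
  apply: hz; rewrite ej tk /ann; apply/smul_rcons; exists z; rewrite subrr.
  by have [] := @smul_submod N (take j s).
have [|z' [hz' pz']] := assoc_prime nR (@smul_submod N (take j s)) (pchain_bot hp).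
  exists z => r hr; apply: hz; rewrite ej tk /ann; apply/smul_rcons; exists 0.
  by rewrite scaler0 subr0.
exists (ann (smul (take j s)) z'); split; first by exists z'.
apply: pchain_cons hp => //; split=> //; exists s`_j => //.
rewrite /ann => /in_smulP/(reg j js)/in_smulP h; case: (pz') => _ n1 _; apply: n1.
by rewrite /ann scale1r.
Qed.

(** If the [x] avoiding the first [k] primes lies in [P k], add [y * z] with [y] in [I], [z] in the
    first [k] primes, and both outside [P k]. Such [z] exists, as an inclusion of [P n] in [P k]
    would be an equality and put [x] in [P n]. *)
Lemma prime_avoidance (I : R -> Prop) k (P : nat -> R -> Prop) : is_ideal I ->
  (forall n, (n < k)%N -> is_prime (P n) /\ exists2 x, I x & ~ P n x) ->
  (forall i j, (i < k)%N -> (j < k)%N -> (forall x, P i x -> P j x) -> forall x, P j x -> P i x) ->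
  exists2 x, I x & forall n, (n < k)%N -> ~ P n x.
Proof.
move=> hI; elim: k => [|k IH] hP anti; first by exists 0; [exact: hI.1 | ].
have [n nk|i j ik jk|x Ix hx] := IH; [exact/hP/ltnW | exact: anti (ltnW ik) (ltnW jk) |].
have [Pkx|nPkx] := pselect (P k x); last first.
  by exists x => // n; rewrite ltnS leq_eqVlt => /orP[/eqP->|/hx].
have [hPk [y Iy nPky]] := hP k (ltnSn k); have [iPk _ _] := hPk.
have [z nPkz hz] : exists2 z, ~ P k z & forall n, (n < k)%N -> P n z.
  have h n : (n < k)%N -> exists2 a, P n a & ~ P k a.
    move=> nk; apply: contrapT => no; apply: (hx n nk).
    apply: (anti n k) => //; first exact: ltnW.
    by move=> a Pa; apply: contrapT => nPa; apply: no; exists a.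
  suff h' j : (j <= k)%N -> exists2 z, ~ P k z & forall n, (n < j)%N -> P n z by exact: h'.
  elim: j => [|j IHj] jk; first by exists 1; [case: hPk | ].
  have [z nz hz] := IHj (ltnW jk).
  have [a Pa na] := h j jk; exists (a * z); first exact: primeM.
  move=> n; rewrite ltnS leq_eqVlt => /orP[/eqP->|nj].
    by have [[ij _ _] _] := hP j (ltnW jk); exact: (idealMl _ ij).
  have [[ij _ _] _] := hP n (ltnW (ltn_trans nj jk)); exact: (idealM _ ij (hz _ nj)).
exists (x + y * z); first by apply: (idealD hI) => //; exact: (idealMl _ hI).
move=> n; rewrite ltnS leq_eqVlt => /orP[/eqP->|nk] Pn.
  have : P k (y * z) by rewrite -[y * z](addKr x) addrC; apply: (idealB iPk).
  exact: primeM.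
apply: (hx n nk); have [[iPn _ _] _] := hP n (ltnW nk).
rewrite -[x](addrK (y * z)); apply: (idealB iPn) => //.
exact: (idealM _ iPn (hz _ nk)).
Qed.

(* The zero divisors on [N] form the union of the maximal annihilators, of which
   finitely many suffice as [N] is Noetherian. *)
Lemma regular_or_socle N : fin_gen N ->
  (exists2 x, m x & forall z : N, x *: z = 0 -> z = 0) \/
  exists2 z : N, z <> 0 & forall x, m x -> x *: z = 0.
Proof.
move=> fN; have nN := noeth_fin_gen nR fN.
pose A (z : N) := ann (fun y : N => y = 0) z.
have hA z : is_ideal (A z) by apply: ann_ideal; split=> // a x y -> ->; rewrite scaler0 addr0.
pose mx (z : N) := z <> 0 /\ forall w, w <> 0 -> (forall r, A z r -> A w r) -> forall r, A w r -> A z r.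
have mx_above z : z <> 0 -> exists2 w, mx w & forall r, A z r -> A w r.
  move=> z0; pose P (S : R^o -> Prop) := exists w, [/\ w <> 0, forall r, A z r -> A w r & S = A w].
  have [||_ [w [w0 zw ->]] wmax] := @noeth_max R R^o P nR.
  - by move=> _ [w [_ _ ->]]; exact: hA.
  - by exists (A z), z.
  exists w => //; split=> // u u0 wu; apply: (wmax (A u)) => //; exists u; split=> // r /zw/wu //.
have mx_prime z : mx z -> is_prime (A z).
  move=> [z0 zmax]; split; first exact: hA.
    by rewrite /A /ann scale1r.
  move=> r s rs; apply: contrapT => /not_orP[nr ns]; apply: nr.
  apply: (zmax (s *: z)) => //; last by rewrite /A /ann scalerA.
  by move=> a; rewrite /A /ann scalerA mulrC -scalerA => ->; rewrite scaler0.
(* Take [l] with maximal span. Any further [z] lies in it, so if no [A w] with [w] in [l] were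
   inside the prime [A z], a product of elements of the [A w] outside [A z] would kill [z]. *)
pose P (S : N -> Prop) := exists2 l, (forall z, z \in l -> mx z) & S = span l.
have [||_ [l hl ->] lmax] := @noeth_max R N P nN.
- by move=> _ [l _ ->]; exact: span_submod.
- by exists (span [::]), [::].
have below z : mx z -> exists2 w, w \in l & forall r, A w r -> A z r.
  move=> hz; have : span l z.
    apply: (lmax (span (z :: l))); last by apply: span_mem; rewrite mem_head.
      by exists (z :: l) => // w; rewrite inE => /orP[/eqP->|/hl].
    move=> x hx; exists 0; by rewrite scale0r subr0.
  move=> lz; apply: contrapT => no.
  have [r nr hr] : exists2 r, ~ A z r & forall w, w \in l -> A w r.
    have : forall w, w \in l -> exists2 a, A w a & ~ A z a.
      move=> w wl; apply: contrapT => no'; apply: no; exists w => // a wa.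
      by apply: contrapT => na; apply: no'; exists a.
    elim: (l) => [|w l' IH] h; first by exists 1 => //; case: (mx_prime _ hz).
    have [u ul|r nr hr] := IH; first by apply: h; rewrite inE ul orbT.
    have [a wa na] := h w (mem_head _ _); exists (a * r).
      exact: (primeM (mx_prime _ hz)).
    move=> u; rewrite inE => /orP[/eqP->|ul]; first exact: (idealMl _ (hA _)).
    exact: (idealM _ (hA _) (hr _ ul)).
  apply: nr; apply: (span_min _ hr lz).
  by split=> [|a x y hx hy]; rewrite /A /ann ?scaler0 // scalerDr scalerA mulrC -scalerA hx hy scaler0 addr0.
have [[z zl mz]|no] := pselect (exists2 z, z \in l & forall x, m x -> A z x).
  by right; exists z => //; case: (hl z zl).
have lP n : (n < size l)%N -> mx l`_n by move=> nl; apply: hl; exact: mem_nth.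
left; have [|n nl|i j il jl ij|x mx_x hx] := @prime_avoidance m (size l) (fun n => A l`_n).
- exact: local_ideal hm.
- split; first exact/mx_prime/lP.
  apply: contrapT => no'; apply: no; exists l`_n; first exact: mem_nth.
  by move=> x mx'; apply: contrapT => nx; apply: no'; exists x.
- by apply: (lP i il).2 => //; case: (lP j jl).
exists x => // z xz; apply: contrapT => z0.
have [w hw zw] := mx_above z z0; have [u ul uw] := below w hw.
have n_l : (index u l < size l)%N by rewrite index_mem.
apply: (hx _ n_l); rewrite nth_index //.
by apply: (hl u ul).2; [case: hw | exact: uw | exact: zw].
Qed.

End RegularSequences.

(** * Finite minimal complexes *)

Section MinimalComplexes.
Variable R : comNzRingType.
Hypothesis nR : noeth R^o.
Variable m : R -> Prop.
Hypothesis hm : is_local m.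
Implicit Types L V N Q : lmodType R.

Definition cx_zero (C : fcx R) : Prop := forall i, dm C i.+1 *m dm C i = 0.

Lemma exact_cx_zero C : exact_cx C -> cx_zero C.
Proof. by move=> h i; exact: mexact_mul0. Qed.

Lemma nakayama_mod N : fin_gen N -> (forall x : N, msub m (fun _ => True) x) -> zero_module N.
Proof.
move=> fN h x; have nN := noeth_fin_gen nR fN.
have U0 : submod (fun y : N => y = 0) by split=> // a u v -> ->; rewrite scaler0 addr0.
apply: (nakayama_fgs hm U0 (nN _ (@submod_setT R N))) => // {}x _.
by exists x; rewrite ?subrr.
Qed.

Lemma msub1 N (a : R) (x : N) : m a -> msub m (fun _ => True) (a *: x).
Proof. by move=> ma; exists 1%N, (fun _ => a), (fun _ => x); rewrite big_ord1. Qed.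

(** By the long exact sequence of multiplication by [x] on [N], the homology for [Q] sits between
    that for [N] in the same degree and one degree lower. *)
Lemma texact_quo N Q (C : fcx R) (x : R) (f : {linear N -> Q}) p : cx_zero C ->
  (forall z : N, x *: z = 0 -> z = 0) -> surjective_fun f ->
  (forall v, f v = 0 <-> exists w, x *: w = v) ->
  texact N (dm C p.+1) (dm C p) -> texact N (dm C p.+2) (dm C p.+1) ->
  texact Q (dm C p.+2) (dm C p.+1).
Proof.
move=> hC xreg fs f0 ex1 ex2 w' hw'.
have /choice[w hw] : forall i, exists z, f z = w' i by move=> i; exact: fs.
have {hw} ew : tlin f (finfun w) = w' by apply/ffunP => i; rewrite !ffunE hw.
move: hw'; rewrite -ew tmap_lin => /ffunP hw'.
have /choice[y hy] : forall j, exists z, x *: z = tmap (dm C p.+1) (finfun w) j.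
  by move=> j; apply/f0; move: (hw' j); rewrite !ffunE.
have ey : x *: finfun y = tmap (dm C p.+1) (finfun w) by apply/ffunP => j; rewrite !ffunE hy ffunE.
have /ex1[y' ey'] : tmap (dm C p) (finfun y) = 0.
  have e : x *: tmap (dm C p) (finfun y) = 0 by rewrite -linearZ /= ey -tmap_mul hC tmap0.
  apply/ffunP => j; rewrite [RHS]ffunE; apply: xreg.
  by move/ffunP/(_ j): e; rewrite [RHS]ffunE ffunE.
have /ex2[u eu] : tmap (dm C p.+1) (finfun w - x *: y') = 0.
  by rewrite linearB linearZ /= -ey' ey subrr.
exists (tlin f u); rewrite tmap_lin -eu; apply/ffunP => i.
rewrite !ffunE linearB; suff -> : f (x *: y' i) = 0 by rewrite subr0.
by apply/f0; exists (y' i).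
Qed.

Lemma smul_quo N Q (x : R) (f : {linear N -> Q}) (s : seq R) v : surjective_fun f ->
  (forall v, f v = 0 <-> exists w, x *: w = v) -> smul s (f v) <-> smul (x :: s) v.
Proof.
move=> fs f0 /=; elim: s v => [|y t IH] v /=.
  rewrite f0; split=> [[w <-]|[w /eqP]]; first by exists w; rewrite subrr.
  by rewrite subr_eq0 => /eqP->; exists w.
split=> [[w']|[w [u h]]].
  have [w <-] := fs w'; rewrite -linearZ -linearB => /IH[u h].
  by exists u, w; rewrite addrAC.
by exists (f u); rewrite -linearZ -linearB; apply/IH; exists w; rewrite addrAC.
Qed.

Lemma quo_regular_seq N Q (x : R) (f : {linear N -> Q}) (s : seq R) : surjective_fun f ->
  (forall v, f v = 0 <-> exists w, x *: w = v) -> (forall z : N, x *: z = 0 -> z = 0) ->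
  regular_seq Q s -> regular_seq N (x :: s).
Proof.
move=> fs f0 xreg [reg [v' nv']]; split; last first.
  have [v fv] := fs v'; exists v => /in_smulP/(smul_quo s v fs f0).
  by rewrite fv => /in_smulP.
case=> [_ v|i i_s v] /=; first by move=> /in_smulP /= h; apply/in_smulP => /=; exact: xreg.
move=> /in_smulP/(smul_quo _ _ fs f0); rewrite linearZ => /in_smulP/(reg i i_s)/in_smulP h.
by apply/in_smulP/(smul_quo _ _ fs f0).
Qed.

(* The last differential of [N (x) C] is injective with entries in [m], so [m] kills
   no nonzero element of [N] and contains a nonzero divisor [x] on [N]; modulo [x]
   the complex stays exact away from the last spot, and the length drops by one. *)
Lemma depth_complex N (C : fcx R) p : fin_gen N -> ~ zero_module N -> cx_zero C ->
  min_cx m C -> (forall i, texact N (dm C i.+1) (dm C i)) ->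
  rk C p <> 0%N -> rk C p.+1 = 0%N ->
  exists s, [/\ forall x, x \in s -> m x, regular_seq N s & size s = p].
Proof.
elim: p N C => [|p IH] N C fN N0 dC mC ex rp rp1.
  exists [::]; split=> //; split=> //.
  by move/existsNP: N0 => [v nv]; exists v => /in_smulP.
have [[x mx xreg]|[z z0 mz]] := regular_or_socle nR hm fN; last first.
  case: z0; have [|u /ffunP] := ex p [ffun _ => z].
    by apply/ffunP => j; rewrite !ffunE big1 // => i _; rewrite ffunE mz //; exact: mC.
  case: (rk C p.+1) rp (dm C p.+1) => // r _ D /(_ ord0); rewrite !ffunE => ->.
  by rewrite big1 // => i _; exfalso; case: i => i; rewrite rp1.
pose hx := submod_range ( *:%R x : {linear N -> N}).
pose f : {linear N -> quo hx} := quo_pi hx.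
have fs : surjective_fun f by exact: quo_pi_surj.
have f0 v : f v = 0 <-> exists w, x *: w = v by exact: quo_pi0.
have [|||||s [sm reg sz]] := IH (quo hx) (ftail C) _ _ _ _ _ rp rp1.
- have /fin_genP[n [w hw]] := fN; apply/fin_genP; exists n, (tlin f w) => y.
  have [v <-] := fs y; have [u <-] := hw v; exists u; by rewrite lin_comb.
- move=> zQ; apply: N0; apply: nakayama_mod => // v.
  by have /f0[w <-] : f v = 0 by [exact: zQ]; exact: msub1.
- by move=> i; exact: dC.
- by move=> i; exact: mC.
- by move=> i; exact: (@texact_quo N _ C x f i dC xreg fs f0 (ex i) (ex i.+1)).
exists (x :: s); split; last by rewrite /= sz.
  by move=> y; rewrite inE => /orP[/eqP->|/sm].
exact: (quo_regular_seq fs f0 xreg reg).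
Qed.

(* [coker D (x) N = 0] forces [coker D = 0] for nonzero [N]. *)
Lemma tmap_onto_free N p q (D : 'M[R]_(p, q)) : fin_gen N -> ~ zero_module N ->
  (forall v : {ffun 'I_q -> N}, exists u, v = tmap D u) ->
  forall v : 'rV_q, exists u, v = u *m D.
Proof.
move=> fN N0 onto v.
have nC := noeth_fin_gen nR (coker_fin_gen D).
have [n [w [hw wm]]] := min_gens hm (nC _ (submod_setT _)).
pose f : {linear 'rV_q -> coker D} := quo_pi (submod_range (rmul D)).
have fD u : f (u *m D) = 0 by apply/quo_pi0; exists u.
case: n => [|n] in w hw wm *.
  suff /quo_pi0[u <-] : f v = 0 by exists u.
  by have [u <-] := (hw (f v)).1 I; rewrite /lcomb big_ord0.
(* The coefficient of [w ord0], well defined modulo [m], is 1 on the lift [b] of [w ord0] and 0 on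
   the rows of [D]. Applied to the tuple of the [b 0 j *: x], which is [tmap D u], it puts every [x]
   in m N. *)
case: N0; apply: nakayama_mod => // x.
have /choice[c hc] : forall j, exists c, lcomb w c = f (delta_mx 0 j) by move=> j; apply/hw.
have fE u : f u = lcomb w (\sum_j u 0 j *: c j).
  rewrite {1}[u]row_sum_delta !linear_sum; apply: eq_bigr => j _.
  by rewrite !linearZ /= hc.
have [b fb] := @quo_pi_surj _ _ _ (submod_range (rmul D)) (w ord0).
have hD i : m (\sum_j D i j * c j 0 ord0).
  have /wm/(_ ord0) : lcomb w (\sum_j row i D 0 j *: c j) = 0.
    by rewrite -fE rowE fD.
  by rewrite summxE; under eq_bigr => j _ do rewrite !mxE.
have hb : m (\sum_j b 0 j * c j 0 ord0 - 1).
  have /wm/(_ ord0) : lcomb w (\sum_j b 0 j *: c j - delta_mx 0 ord0) = 0.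
    by rewrite linearB /= lcomb_delta -fE [f b]fb subrr.
  by rewrite !mxE summxE !eqxx; under eq_bigr => j _ do rewrite !mxE.
have [u hu] := onto [ffun j => b 0 j *: x].
have e : \sum_j c j 0 ord0 *: (b 0 j *: x) = \sum_i (\sum_j D i j * c j 0 ord0) *: u i.
  transitivity (\sum_j c j 0 ord0 *: tmap D u j).
    by apply: eq_bigr => j _; rewrite -hu ffunE.
  under eq_bigr => j _ do rewrite ffunE scaler_sumr.
  rewrite exchange_big; apply: eq_bigr => i _; rewrite scaler_suml.
  by apply: eq_bigr => j _; rewrite scalerA mulrC.
have {}e : x = (1 - \sum_j b 0 j * c j 0 ord0) *: x +
    \sum_i (\sum_j D i j * c j 0 ord0) *: u i.
  rewrite -e scalerBl scale1r scaler_suml [X in _ - X + _](_ : _ = \sum_j c j 0 ord0 *: (b 0 j *: x)).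
    by rewrite subrK.
  by apply: eq_bigr => j _; rewrite scalerA mulrC.
exists p.+1, (fun i => if unlift ord0 i is Some k then \sum_j D k j * c j 0 ord0
               else 1 - \sum_j b 0 j * c j 0 ord0),
             (fun i => if unlift ord0 i is Some k then u k else x); split=> // [i|].
  case: (unlift ord0 i) => [k|]; first exact: hD.
  by rewrite -opprB; apply: idealN => //; exact: local_ideal hm.
rewrite big_ord_recl unlift_none {1}e; congr (_ + _).
by apply: eq_bigr => i _; rewrite liftK.
Qed.

Lemma mul0_col p q r (A : 'M[R]_(p, q)) (B : 'M[R]_(q, r)) : q = 0%N -> A *m B = 0.
Proof. by move=> q0; subst q; rewrite [A]thinmx0 mul0mx. Qed.

(* [t0] and [t1] start a chain map from the dual of [G], which is bounded, to the
   exact complex [A]; such a map is null-homotopic. *)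
Lemma dual_homotopy (A G : fcx R) j (t0 : 'M[R]_(rk G 0, rk A j.+1)) (t1 : 'M[R]_(rk G 1, rk A j)) :
  exact_cx A -> exact_cx G -> rk G j.+1 = 0%N ->
  t0 *m dm A j = (dm G 0)^T *m t1 ->
  exists s0 s1, t0 = s0 *m dm A j.+1 + (dm G 0)^T *m s1.
Proof.
move=> hA; elim: j G t0 t1 => [|j IH] G t0 t1 hG G0 e.
  have [s hs] : exists s, t0 = s *m dm A 1.
    by apply: mexact_mx (hA 0%N) _; rewrite e mul0_col.
  by exists s, 0; rewrite mulmx0 addr0.
(* Exactness of [G] extends the chain map by one more square; the induction on the tail then gives
   the homotopy for [t1], and exactness of [A] that for [t0]. *)
have [t2t ht2] : exists D, (dm A j)^T *m t1^T = D *m dm G 1.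
  apply: mexact_mx (hG 0%N) _; rewrite -mulmxA.
  have -> : t1^T *m dm G 0 = (dm A j.+1)^T *m t0^T by rewrite -trmx_mul e trmx_mul trmxK.
  by rewrite mulmxA -trmx_mul (mexact_mul0 (hA j)) trmx0 mul0mx.
have [|s0 [s1 es]] := IH (ftail G) t1 t2t^T (ftail_exact hG) G0.
  by rewrite -[LHS]trmxK trmx_mul ht2 trmx_mul.
have [s hs] : exists s, t0 - (dm G 0)^T *m s0 = s *m dm A j.+2.
  apply: mexact_mx (hA j.+1) _; rewrite mulmxBl e {1}es mulmxDr /= !mulmxA -trmx_mul.
  by rewrite (mexact_mul0 (hG 0%N)) trmx0 mul0mx addr0 subrr.
by exists s, s0; rewrite -hs subrK.
Qed.

Lemma lin_in_mx p q (h : {linear 'rV[R]_p -> 'rV[R]_q}) v : in_mx m v -> in_mx m (h v).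
Proof.
move=> hv i j; rewrite lin_lcomb summxE; apply: ideal_sum (local_ideal hm) _ => k _.
by rewrite mxE; apply: idealMl (local_ideal hm) (hv _ _).
Qed.

(** Above [d] the composite through the bounded resolution is zero, so the identity there is a sum
    of terms passing through differentials with entries in [m]. *)
Lemma min_res_bounded L (C : fcx R) (e : {ffun 'I_(rk C 0) -> L}) d : resolves e ->
  min_cx m C -> resolution_bounded L d -> forall i : nat, d < i%:Z -> rk C i = 0%N.
Proof.
move=> he mC [P zP] i di; have [f [g [h [hf hg e0 eS]]]] := resolution_retract (fres_proj he) P.
have h1 v : in_mx m (v : 'rV[R]_(rk C i)).
  case: i di v => [|i] di v.
    have := e0 v; rewrite (zP _ di (f 0%N v)) linear0 => /eqP; rewrite eq_sym addr_eq0 => /eqP->.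
    by rewrite -mulNmx; exact/(in_mxMl hm)/mC.
  have := eS i v; rewrite (zP _ di (f i.+1 v)) linear0 => /eqP; rewrite eq_sym addr_eq0 => /eqP->.
  rewrite opprD; apply: (in_mxD hm); first by rewrite -mulNmx; exact/(in_mxMl hm)/mC.
  by rewrite -linearN; apply: lin_in_mx; rewrite -mulNmx; exact/(in_mxMl hm)/mC.
case: (rk C i) h1 => // r h1; have := h1 (delta_mx 0 ord0) 0 ord0.
by rewrite mxE !eqxx; case: hm => _ n1 _ /n1.
Qed.

(** After a zero module, exactness makes the next one the image of its incoming differential, hence
    equal to [m] times itself. *)
Lemma min_res_rk0 (C : fcx R) n : exact_cx C -> min_cx m C -> rk C n = 0%N ->
  forall i, (n <= i)%N -> rk C i = 0%N.
Proof.
move=> hC mC r0; elim=> [|i IH]; first by rewrite leqn0 => /eqP n0; rewrite n0 in r0.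
rewrite leq_eqVlt => /orP[/eqP<-//|]; rewrite ltnS => /IH ri.
have h1 v : in_mx m (v : 'rV[R]_(rk C i.+1)).
  have [u ->] : exists u, v = u *m dm C i.+1.
    apply/(hC i); apply/rowP => k; exfalso; case: k => k; by rewrite ri.
  exact/(in_mxMl hm)/mC.
case: (rk C i.+1) h1 => // r h1; have := h1 (delta_mx 0 ord0) 0 ord0.
by rewrite mxE !eqxx; case: hm => _ n1 _ /n1.
Qed.

End MinimalComplexes.

(** * The minimal resolution of the residue field *)

Section ResidueField.
Variable R : comNzRingType.
Hypothesis nR : noeth R^o.
Variable m : R -> Prop.
Hypothesis hm : is_local m.

Definition eqm p q (A B : 'M[R]_(p, q)) : Prop := in_mx m (A - B).

Lemma eqmMl p q r (A : 'M[R]_(p, q)) (B C : 'M[R]_(q, r)) : eqm B C -> eqm (A *m B) (A *m C).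
Proof. by rewrite /eqm -mulmxBr; exact: in_mxMl. Qed.

(** [s0] says that [x] kills the cokernel of [dm C 0], so multiplication by [x] is a lift of the
    zero map and null-homotopic. *)
Lemma min_res_homotopy (C : fcx R) (x : R) (s0 : 'M[R]_(rk C 0, rk C 1)) : exact_cx C ->
  s0 *m dm C 0 = x%:M ->
  exists s : forall i, 'M[R]_(rk C i, rk C i.+1), s 0%N = s0 /\
    forall i, s i.+1 *m dm C i.+1 + dm C i *m s i = x%:M.
Proof.
move=> hC e0; pose K i (s : 'M[R]_(rk C i, rk C i.+1)) := (x%:M - dm C i *m s) *m dm C i = 0.
have K0 : K 0%N s0 by rewrite /K mulmxBl -mulmxA e0 mul_scalar_mx mul_mx_scalar subrr.
have step i (s : {s | K i s}) : exists t : {t | K i.+1 t},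
    sval t *m dm C i.+1 + dm C i *m sval s = x%:M.
  case: s => s Ks /=; have [t ht] := mexact_mx (hC i) Ks.
  have Kt : K i.+1 t.
    rewrite /K mulmxBl -mulmxA -ht mulmxBr mulmxA (mexact_mul0 (hC i)) mul0mx subr0.
    by rewrite mul_scalar_mx mul_mx_scalar subrr.
  by exists (exist _ t Kt); rewrite /= -ht subrK.
have [s [s00 hs]] := dep_choice step (exist _ s0 K0).
by exists (fun i => sval (s i)); split=> [|i]; [rewrite s00 | exact: hs].
Qed.

(* With [x_1, .., x_e] minimal generators of [m], let [s_j] be a homotopy for
   multiplication by [x_j] and write the differential as [d = \sum_l x_l D_l].
   Then [D_l s_j + s_j D_l] is the identity or zero modulo [m] as [j = l] or not,
   so applying [D_1], .., [D_e] in turn to [s_1 ... s_e 1] gives back [1] modulo [m]. *)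
Lemma residue_rank (C : fcx R) e (x : {ffun 'I_e -> R^o}) : exact_cx C -> min_cx m C ->
  rk C 0 <> 0%N ->
  (forall a, m a <-> exists v, lcomb x v = a) ->
  (forall v, lcomb x v = 0 -> forall i, m (v 0 i)) ->
  (forall j, exists s0, s0 *m dm C 0 = (x j)%:M) -> rk C e <> 0%N.
Proof.
move=> hC mC C0 genx minx hs0.
have /choice[s hs] : forall j, exists s : forall i, 'M[R]_(rk C i, rk C i.+1),
    s 0%N *m dm C 0 = (x j)%:M /\ forall i, s i.+1 *m dm C i.+1 + dm C i *m s i = (x j)%:M.
  move=> j; have [s0 hj] := hs0 j.
  by have [s [s00 h]] := min_res_homotopy hC hj; exists s; rewrite s00.
have minx' p q (A : 'I_e -> 'M[R]_(p, q)) : \sum_l x l *: A l = 0 -> forall l, in_mx m (A l).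
  move=> h l i j; have : lcomb x (\row_k A k i j) = 0.
    transitivity ((\sum_l x l *: A l) i j); last by rewrite h mxE.
    by rewrite summxE; apply: eq_bigr => k _; rewrite !mxE mulrC.
  by move=> /minx/(_ l); rewrite mxE.
have genx' p q (A : 'M[R]_(p, q)) : in_mx m A -> exists B : 'I_e -> 'M[R]_(p, q), A = \sum_l x l *: B l.
  move=> hA; have /choice[f hf] : forall ij : 'I_p * 'I_q, exists v, lcomb x v = A ij.1 ij.2.
    by move=> ij; apply/genx.
  exists (fun l => \matrix_(i, j) f (i, j) 0 l); apply/matrixP => i j.
  by rewrite summxE -(hf (i, j)); apply: eq_bigr => l _; rewrite !mxE mulrC.
pose D i := sval (cid (genx' _ _ _ (mC i))).
have hD i : dm C i = \sum_l x l *: D i l := svalP (cid (genx' _ _ _ (mC i))).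
have xsum p j : \sum_l x l *: (l == j)%:R%:M = (x j)%:M :> 'M[R]_p.
  rewrite (bigD1 j) //= eqxx scalemx1 big1 ?addr0 // => l /negPf->.
  by rewrite raddf0 scaler0.
(* These relations compare the coefficients of the generators [x l] in the homotopy identities;
   [minx'] permits this modulo [m]. *)
have rel0 j l : eqm (s j 0%N *m D 0%N l) (l == j)%:R%:M.
  apply: (minx' _ _ (fun l => s j 0%N *m D 0%N l - (l == j)%:R%:M)).
  under eq_bigr => k _ do rewrite scalerBr scalemxAr.
  by rewrite sumrB -mulmx_sumr -hD xsum (hs j).1 subrr.
have relS i j l : eqm (s j i.+1 *m D i.+1 l + D i l *m s j i) (l == j)%:R%:M.
  apply: (minx' _ _ (fun l => s j i.+1 *m D i.+1 l + D i l *m s j i - (l == j)%:R%:M)).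
  under eq_bigr => k _ do rewrite scalerBr scalerDr scalemxAr scalemxAl.
  by rewrite sumrB big_split /= -mulmx_sumr -mulmx_suml -!hD xsum (hs j).2 subrr.
(* For [js] with entries j1, .., jr this is [const_mx 1] times [s jr 0], .., [s j1 (r - 1)]; the
   start only has to be nonzero modulo [m]. *)
pose u := fix u (js : seq 'I_e) : 'rV[R]_(rk C (size js)) :=
  if js is j :: t return 'rV_(rk C (size js)) then u t *m s j (size t) else const_mx 1.
have uD1 j l js : l \notin j :: js -> in_mx m (u (j :: js) *m D (size js) l).
  elim: js j => [|j' js IH] j.
    rewrite inE => lj; have := eqmMl (u [::]) (rel0 j l).
    by rewrite (negPf lj) raddf0 mulmx0 /eqm subr0 mulmxA.
  rewrite inE negb_or => /andP[lj /IH h].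
  have := eqmMl (u (j' :: js)) (relS (size js) j l).
  rewrite (negPf lj) raddf0 mulmx0 /eqm subr0 mulmxDr !mulmxA => h'.
  rewrite -[X in in_mx m X](addrK (u (j' :: js) *m D (size js) l *m s j (size js))).
  apply: (in_mxD hm h'); rewrite -mulNmx; apply: (in_mxMr hm).
  by rewrite -mulmxN -scaleN1r -scalemxAr => a b; rewrite mxE; exact: (idealM _ (local_ideal hm) (h a b)).
have uD2 j js : j \notin js -> eqm (u (j :: js) *m D (size js) j) (u js).
  case: js => [|j' js] hj.
    by have := eqmMl (u [::]) (rel0 j j); rewrite eqxx mulmx1 mulmxA.
  have := eqmMl (u (j' :: js)) (relS (size js) j j).
  rewrite eqxx mulmx1 /eqm mulmxDr !mulmxA => h'.
  rewrite -[X in in_mx m X](addrK (u (j' :: js) *m D (size js) j *m s j (size js))).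
  rewrite (addrAC _ (- u (j' :: js))); apply: (in_mxD hm h'); rewrite -mulNmx; apply: (in_mxMr hm) => a b.
  by rewrite mxE; exact: (idealN (local_ideal hm) (uD1 j' j js hj a b)).
have unz js : uniq js -> ~ in_mx m (u js).
  elim: js => [_|j js IH /= /andP[jjs ujs] h].
    have lt0 : (0 < rk C 0)%N by rewrite lt0n; apply/eqP.
    by move=> /(_ 0 (Ordinal lt0)); rewrite mxE; case: hm.
  apply: (IH ujs); have := uD2 j js jjs; rewrite /eqm => h'.
  rewrite -[u js](subKr (u (j :: js) *m D (size js) j)); apply: (in_mxD hm).
    exact: (in_mxMr hm).
  by move=> a b; rewrite mxE; exact: (idealN (local_ideal hm) (h' a b)).
move=> r0; apply: (unz _ (enum_uniq 'I_e)); move: (u _).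
by rewrite size_enum_ord r0 => v a [].
Qed.

End ResidueField.

(** * Dimension shifting *)

Section Shifting.
Variable R : comNzRingType.
Implicit Types V W N : lmodType R.

(** [texact] for a submodule given as a predicate, so that syzygies and cosyzygies can be
    coefficients without becoming types. *)
Definition stexact V (Z : V -> Prop) p q r (A : 'M[R]_(p, q)) (B : 'M[R]_(q, r)) : Prop :=
  forall w : {ffun 'I_q -> V}, (forall i, Z (w i)) -> tmap B w = 0 ->
  exists2 u : {ffun 'I_p -> V}, (forall i, Z (u i)) & w = tmap A u.

Lemma stexact0 V (Z : V -> Prop) p q r (A : 'M[R]_(p, q)) (B : 'M[R]_(q, r)) :
  Z 0 -> (forall x, Z x -> x = 0) -> stexact Z A B.
Proof.
move=> Z0 hZ w wZ _; exists 0; first by move=> i; rewrite ffunE.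
by rewrite linear0; apply/ffunP => i; rewrite ffunE; exact: hZ.
Qed.

Lemma tlin_lift V W p (f : {linear V -> W}) (w : {ffun 'I_p -> W}) :
  (forall i, exists x, f x = w i) -> exists v, tlin f v = w.
Proof. by move=> /choice[v hv]; exists (finfun v); apply/ffunP => i; rewrite !ffunE. Qed.

(** The connecting map of 0 -> ker f -> V -> im f -> 0: the image is exact one degree above the
    kernel. *)
Lemma stexact_im V W (f : {linear V -> W}) o p q r
    (A0 : 'M[R]_(o, p)) (A : 'M[R]_(p, q)) (B : 'M[R]_(q, r)) : A *m B = 0 ->
  stexact (fun x => f x = 0) A B -> texact V A0 A ->
  stexact (fun y => exists x, f x = y) A0 A.
Proof.
move=> AB ker ex w /tlin_lift[v <-]; rewrite tmap_lin => /ffunP h.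
have [i||u u0 eu] := ker (tmap A v).
- by move: (h i); rewrite !ffunE.
- by rewrite -tmap_mul AB tmap0.
have [|x ex'] := ex (v - u); first by rewrite linearB /= eu subrr.
exists (tlin f x); first by move=> i; exists (x i); rewrite ffunE.
rewrite tmap_lin -ex'; apply/ffunP => i.
by rewrite !ffunE linearB u0 subr0.
Qed.

Lemma stexact_ker V W (f : {linear V -> W}) o p q r
    (A0 : 'M[R]_(o, p)) (A : 'M[R]_(p, q)) (B : 'M[R]_(q, r)) : A0 *m A = 0 ->
  stexact (fun y => exists x, f x = y) A0 A -> texact V A B ->
  stexact (fun x => f x = 0) A B.
Proof.
move=> A0A im ex w w0 /ex[u eu]; have fw : tmap A (tlin f u) = 0.
  by rewrite tmap_lin -eu; apply/ffunP => i; rewrite !ffunE.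
have [i|y /tlin_lift[x <-] ey] := im (tlin f u) _ fw; first by exists (u i); rewrite ffunE.
exists (u - tmap A0 x); last by rewrite linearB /= -eu -tmap_mul A0A tmap0 subr0.
move=> i; move/ffunP/(_ i): ey; rewrite tmap_lin !ffunE => e.
by rewrite linearB /= e subrr.
Qed.

Lemma texact_rV n p q r (A : 'M[R]_(p, q)) (B : 'M[R]_(q, r)) : mexact A B ->
  texact 'rV[R]_n A B.
Proof.
move=> hAB w hw; pose W : 'M[R]_(n, q) := \matrix_(k, i) w i 0 k.
have [D hD] : exists D, W = D *m A.
  apply: mexact_mx hAB _; apply/matrixP => k j; rewrite [RHS]mxE.
  move/ffunP/(_ j)/rowP/(_ k): hw; rewrite !ffunE summxE [RHS]mxE => h.
  by rewrite -[RHS]h mxE; apply: eq_bigr => i _; rewrite !mxE mulrC.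
exists [ffun i => \row_k D k i]; apply/ffunP => i; apply/rowP => k.
have := congr1 (fun M : 'M_(n, q) => M k i) hD; rewrite !mxE => ->.
by rewrite ffunE summxE; apply: eq_bigr => j _; rewrite !mxE ffunE mxE mulrC.
Qed.

Lemma texact_R p q r (A : 'M[R]_(p, q)) (B : 'M[R]_(q, r)) : mexact A B ->
  texact R^o A B.
Proof.
move=> hAB w hw; have /hAB[u hu] : \row_i w i *m B = 0.
  apply/rowP => j; rewrite !mxE; move/ffunP/(_ j): hw; rewrite !ffunE => h.
  by rewrite -[RHS]h; apply: eq_bigr => i _; rewrite mxE mulrC.
exists [ffun i => u 0 i]; apply/ffunP => i.
have := congr1 (fun v : 'rV_q => v 0 i) hu; rewrite !mxE ffunE => ->.
by apply: eq_bigr => j _; rewrite ffunE mulrC.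
Qed.

(** [w] induces a map on R^q modulo the kernel of [B], which embeds in R^r; injectivity extends it
    to R^r. *)
Lemma texact_injective E p q r (A : 'M[R]_(p, q)) (B : 'M[R]_(q, r)) :
  injective_module E -> mexact A B -> texact E B^T A^T.
Proof.
move=> injE hAB w hw.
have hK := submod_ker (rmul B).
have [|f hf] := linear_factor (@quo_pi_surj _ _ _ hK) (f := rmul B).
  by move=> x /quo_pi0.
have [|g hg] := linear_factor (@quo_pi_surj _ _ _ hK) (f := lcomb w).
  move=> x /quo_pi0/hAB[u ->]; rewrite /= lcomb_mul hw.
  by rewrite /lcomb big1 // => i _; rewrite ffunE scaler0.
have finj : injective f.
  move=> y z; have [y' <-] := quo_pi_surj y; have [z' <-] := quo_pi_surj z.
  rewrite !hf => e; apply/eqP; rewrite -subr_eq0 -linearB; apply/eqP/quo_pi0.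
  by rewrite linearB; apply/eqP; rewrite subr_eq0; apply/eqP.
have [h hh] := injE _ _ f g finj.
have [u hu] := lcomb_surj h; exists u; apply: lcomb_inj => v.
by rewrite -lcomb_mul -hu -hg -hh hf.
Qed.

End Shifting.

(** * Rigid-test modules *)

Section Extrema.

(** The empty set is covered: everything bounds it, so [s] is -oo, the default. *)
Lemma sup_bar_eq (A : set (\bar int)) s : (forall x, A x -> (x <= s)%E) ->
  (forall t, (forall x, A x -> (x <= t)%E) -> (s <= t)%E) -> sup_bar A = s.
Proof.
move=> ub least; rewrite /sup_bar /supremum; case: eqVneq => [A0|_].
  by apply/eqP; rewrite eq_sym -leeNy_eq; apply: least => x; rewrite A0.
by apply: xget_subset1; [split | exact: is_subset1_supremums].
Qed.

Lemma inf_bar_eq (A : set (\bar int)) s : (forall x, A x -> (s <= x)%E) ->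
  (forall t, (forall x, A x -> (t <= x)%E) -> (t <= s)%E) -> inf_bar A = s.
Proof.
move=> lb greatest; rewrite /inf_bar /infimum; case: eqVneq => [A0|_].
  by apply/eqP; rewrite eq_sym -leye_eq; apply: greatest => x; rewrite A0.
by apply: xget_subset1; [split | exact: is_subset1_infimums].
Qed.

Lemma inf_bar_lty (P : int -> Prop) :
  (inf_bar [set d%:E | d in [set d : int | P d]] < +oo)%E -> exists d, P d.
Proof.
move=> h; apply: contrapT => no; move: h; rewrite (_ : [set _ | _ in _] = set0).
  by rewrite /inf_bar /infimum eqxx ltxx.
by apply/seteqP; split=> // x [d Pd _]; apply: no; exists d.
Qed.

End Extrema.

Section RigidTest.
Variable R : comNzRingType.
Hypothesis nR : noeth R^o.
Variable m : R -> Prop.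
Hypothesis hm : is_local m.
Implicit Types L M N : lmodType R.

Lemma min_gen_ideal : exists e (x : {ffun 'I_e -> R^o}),
  (forall a, m a <-> exists v, lcomb x v = a) /\ forall v, lcomb x v = 0 -> forall i, m (v 0 i).
Proof. by apply: (min_gens hm); apply: nR; exact: local_ideal hm. Qed.

Lemma lcomb_span N n (w : {ffun 'I_n -> N}) x : (exists v, lcomb w v = x) <-> span (codom w) x.
Proof.
split=> [[v <-]|].
  apply: submod_sum; first exact: span_submod.
  by move=> i _; apply: submodZ; [exact: span_submod | apply: span_mem; exact: codom_f].
move: x; apply: span_min; first exact: (submod_range (lcomb w)).
by move=> _ /codomP[i ->]; exists (delta_mx 0 i); exact: lcomb_delta.
Qed.

Lemma pchain_min_gens e (x : {ffun 'I_e -> R^o}) n (p q : R -> Prop) :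
  (forall a, m a <-> exists v, lcomb x v = a) -> pchain n p q -> (n <= e)%N.
Proof.
move=> gx h; have := @pchain_bound R nR m hm (codom x) n p q h.
rewrite size_codom card_ord; apply=> [a ax|a /gx/lcomb_span ha].
  by apply/gx/lcomb_span; exact: span_mem.
by exists 0; [case: (pchain_bot h) => [[]] | rewrite subr0].
Qed.

Lemma depth_fin N (mb : {pred R}) : (forall a, a \in mb <-> m a) -> fin_gen N -> ~ zero_module N ->
  exists D : nat, depth mb N = (D%:Z)%:E /\
    forall s, (forall x, x \in s -> m x) -> regular_seq N s -> (size s <= D)%N.
Proof.
move=> mbE fN N0; have [e [x [gx _]]] := min_gen_ideal.
pose P n := `[<exists s, [/\ forall x, x \in s -> m x, regular_seq N s & size s = n]>].
have exP : exists n, P n.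
  exists 0%N; apply/asboolP; exists [::]; split=> //; split=> //.
  by move/existsNP: N0 => [v nv]; exists v => /in_smulP.
have ubP n : P n -> (n <= e)%N.
  move=> /asboolP[s [sm reg <-]].
  by have [p /(pchain_min_gens gx)] := regular_seq_pchain nR hm fN sm reg.
case: (ex_maxnP exP ubP) => D /asboolP[s [sm reg sD]] Dmax.
have Dub t : (forall x, x \in t -> m x) -> regular_seq N t -> (size t <= D)%N.
  by move=> tm treg; apply: Dmax; apply/asboolP; exists t.
exists D; split=> //; apply: sup_bar_eq => [_ [t [tm treg] <-]|b hb].
  by rewrite lee_fin lez_nat; apply: Dub => // y /tm /mbE.
rewrite -sD; apply: hb; exists s => //; split=> // y /sm; by move=> /mbE.
Qed.

Lemma regular1 N x : fin_gen N -> ~ zero_module N -> m x ->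
  (forall z : N, x *: z = 0 -> z = 0) -> regular_seq N [:: x].
Proof.
move=> fN N0 mx xreg; split.
  by case=> // _ v /in_smulP /= h; apply/in_smulP => /=; exact: xreg.
apply: contrapT => /forallNP h; apply: N0; apply: (nakayama_mod nR hm fN) => v.
have /contrapT/in_smulP/= [w /eqP] := h v.
by rewrite subr_eq0 => /eqP->; exact: msub1.
Qed.

Definition join_tup N p q (u : {ffun 'I_p -> N}) (v : {ffun 'I_q -> N}) : {ffun 'I_(p + q) -> N} :=
  [ffun i => match split i with inl j => u j | inr k => v k end].

Lemma tmap_col_mx N p q r (A : 'M[R]_(p, r)) (B : 'M[R]_(q, r)) (u : {ffun 'I_p -> N}) v :
  tmap (col_mx A B) (join_tup u v) = tmap A u + tmap B v.
Proof.
apply/ffunP => j; rewrite !ffunE big_split_ord /=; apply: (congr2 +%R).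
  by apply: eq_bigr => i _; rewrite col_mxEu ffunE (unsplitK (inl i)).
by apply: eq_bigr => i _; rewrite col_mxEd ffunE (unsplitK (inr i)).
Qed.

Lemma tup0 N n (w w' : {ffun 'I_n -> N}) : n = 0%N -> w = w'.
Proof. by move=> n0; apply/ffunP => i; exfalso; case: i => i; rewrite n0. Qed.

Lemma rigid_Tor N L : rigid_test N -> fin_gen L -> Tor_vanishes 1 N L ->
  forall n, Tor_vanishes n.+1 N L.
Proof.
by move=> [_ h] fL T1; elim=> // n IH; have [] := h L fL n.+1 isT IH.
Qed.

Lemma rigid_resolution N L : rigid_test N -> fin_gen L -> forall n, Tor_vanishes n.+1 N L ->
  exists d, resolution_bounded L d.
Proof.
move=> [_ h] fL n T; have [_ hpd] := h L fL n.+1 isT T.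
exact: inf_bar_lty hpd.
Qed.

(* For [n = k + 1] the hypothesis says that [Tor_1] of [N] with the cokernel [Y]
   of the transpose of [d_{n+1}] vanishes; rigidity makes the minimal resolution
   of [Y] finite, and [depth N <= n] bounds its length by [n]. The comparison
   of its dual with the resolution of [M] then contracts the latter at [n]. *)
Lemma Ext_rigidity M N (C : fcx R) (e : {ffun 'I_(rk C 0) -> M}) n :
  resolves e -> min_cx m C -> rigid_test N -> ~ zero_module N ->
  (forall s, (forall x, x \in s -> m x) -> regular_seq N s -> (size s <= n)%N) ->
  Ext_vanishes n M N -> rk C n = 0%N.
Proof.
move=> he mC hrt N0 dep ext; have fN := hrt.1; have [_ _ exC] := he.
case: n => [|k] in dep ext *.
  (* In degree 0, [dep] forbids a nonzerodivisor in [m], so [m] kills some nonzero [z], and by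
     minimality the constant tuple of [z] is a cocycle. *)
  have [[x mx xreg]|[z z0 mz]] := regular_or_socle nR hm fN.
    have m1 y : y \in [:: x] -> m y by rewrite inE => /eqP->.
    by have := dep _ m1 (regular1 fN N0 mx xreg).
  move: ext => /(Ext0_tmap N he)/(_ [ffun _ => z]) h.
  case E : (rk C 0) => [|r] //; case: z0.
  have lt0 : (0 < rk C 0)%N by rewrite E.
  have /ffunP/(_ (Ordinal lt0)) : [ffun _ : 'I_(rk C 0) => z] = 0.
    apply: h; apply/ffunP => j; rewrite !ffunE big1 // => i _; rewrite ffunE mxE mz //.
    exact: mC.
  by rewrite !ffunE.
move: ext => /(Ext_texact N he) ext.
set D := (dm C k.+1)^T in ext.
have [G [B [hB GB exG mG]]] := min_res_sub nR hm (submod_ker (rmul D)).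
have BD : mexact B D by move=> v; exact: hB.
have hY := coker_resolves GB exG BD; set H := fcons (C := fcons B) D in hY.
have fY := coker_fin_gen D; have [_ _ exH] := hY.
have CD0 : (dm C k)^T *m D = 0 by rewrite /D -trmx_mul (mexact_mul0 (exC k)) trmx0.
have [E hE] := mexact_mx BD CD0.
have T1 : Tor_vanishes 1 N (coker D).
  apply/(Tor_texact N hY 0%N) => w /ext[u ->]; exists (tmap E u).
  by rewrite /= -tmap_mul -hE.
have Tn := rigid_Tor hrt fY T1.
have texH i : texact N (dm H i.+1) (dm H i) by apply/(Tor_texact N hY).
(* The cokernel of [col_mx E (dm G 0)] is Ext^n(M, R): [G] covers the kernel of [D], and [E] gives
   the image of [(dm C k)^T] in it. *)
have onto (v : 'rV_(rk G 0)) : exists u : 'rV_(rk C k + rk G 1), v = u *m col_mx E (dm G 0).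
  apply: (tmap_onto_free nR hm fN N0) => xi.
  have [|u hu] := ext (tmap B xi); first by rewrite -tmap_mul (mexact_mul0 BD) tmap0.
  have [|u2 hu2] := texH 1%N (xi - tmap E u).
    by rewrite linearB /= hu hE tmap_mul subrr.
  by exists (join_tup u u2); rewrite tmap_col_mx -hu2 addrC subrK.
have mB : in_mx m B.
  move=> i j; have [u hu] := onto (delta_mx 0 i).
  have : in_mx m ((delta_mx 0 i : 'rV_(rk G 0)) *m B).
    rewrite hu -[u]hsubmxK mul_row_col mulmxDl -!mulmxA (mexact_mul0 GB) mulmx0 addr0 -hE.
    by apply: (in_mxMl hm); apply: in_mx_tr; exact: mC.
  by rewrite -rowE => /(_ 0 j); rewrite mxE.
have mH : min_cx m H by case=> [|[|i]]; [apply: in_mx_tr; exact: mC | exact: mB | exact: mG].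
have [d hd] := rigid_resolution hrt fY (Tn 0%N).
(* A first zero rank beyond [k.+2] would give a regular sequence longer than [n = k.+1]. *)
have H0 : rk H k.+2 = 0%N.
  have exz : exists i, rk H i == 0%N.
    by exists (`|d|.+1)%N; apply/eqP; apply: (min_res_bounded hm hY mH hd); lia.
  case: (ex_minnP exz) => p /eqP p0 pmin.
  have [pk|kp] := leqP p k.+2; first exact: (min_res_rk0 hm exH mH p0).
  case: p => // p in p0 pmin kp *.
  have [||s [sm reg sp]] := @depth_complex R nR m hm N H p fN N0 (exact_cx_zero exH) mH texH.
  - by move=> /eqP/pmin; rewrite ltnn.
  - exact: p0.
  by move: (dep s sm reg); rewrite sp => h; lia.
(* [1%:M] in degree [n] and [E^T] below start a chain map from the dual of [ftail H] to [C]. *)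
have [|s0 [s1 e1]] := @dual_homotopy R C (ftail H) k 1%:M E^T exC (ftail_exact exH) H0.
  by rewrite mul1mx /= -trmx_mul -hE trmxK.
apply: (in_mx1 hm); rewrite e1; apply: (in_mxD hm); first exact/(in_mxMl hm)/mC.
by apply: (in_mxMr hm); exact: in_mx_tr.
Qed.

Lemma res_rk0_bounded M (C : fcx R) (e : {ffun 'I_(rk C 0) -> M}) (d : int) : resolves e ->
  (forall i : nat, d < i%:Z -> rk C i = 0%N) -> resolution_bounded M d.
Proof.
move=> he h; exists (fres_proj he) => i /h /= r0 v.
by apply/rowP => j; exfalso; case: j => j; rewrite r0.
Qed.

Lemma min_res_rk0_neq0 M (C : fcx R) (e : {ffun 'I_(rk C 0) -> M}) : resolves e ->
  ~ zero_module M -> rk C 0 <> 0%N.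
Proof.
move=> [es _ _] M0 r0; apply: M0 => x; have [v <-] := es x.
by rewrite /lcomb big1 // => i; exfalso; case: i => i; rewrite r0.
Qed.

Lemma pd_min_res M (C : fcx R) (e : {ffun 'I_(rk C 0) -> M}) n : resolves e -> min_cx m C ->
  rk C n <> 0%N -> rk C n.+1 = 0%N -> pd M = (n%:Z)%:E.
Proof.
move=> he mC rn rn1; have [_ _ exC] := he; apply: inf_bar_eq => [_ [d hd <-]|b hb].
  rewrite lee_fin leNgt; apply/negP => dn; apply: rn.
  exact: (min_res_bounded hm he mC hd).
apply: hb; exists n%:Z => //; apply: (res_rk0_bounded he) => i; rewrite ltz_nat.
exact: (min_res_rk0 hm exC mC rn1).
Qed.

Lemma pd_infinite M (C : fcx R) (e : {ffun 'I_(rk C 0) -> M}) : resolves e -> min_cx m C ->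
  (forall n, rk C n <> 0%N) -> pd M = +oo%E.
Proof.
move=> he mC rn; apply: inf_bar_eq => [_ [d hd <-]|b hb]; last exact: leey.
exfalso; apply: (rn (`|d|.+1)%N); apply: (min_res_bounded hm he mC hd).
by lia.
Qed.

(** In the top degree every tuple is a cocycle, while coboundaries have entries in m N, which is not
    all of [N]. *)
Lemma Ext_top_nonzero M N (C : fcx R) (e : {ffun 'I_(rk C 0) -> M}) n : resolves e -> min_cx m C ->
  fin_gen N -> ~ zero_module N -> rk C n <> 0%N -> rk C n.+1 = 0%N -> ~ Ext_vanishes n M N.
Proof.
move=> he mC fN N0 rn rn1 ext; have lt0 : (0 < rk C n)%N by rewrite lt0n; apply/eqP.
case: n => [|n] in rn rn1 ext lt0 *.
  move: ext => /(Ext0_tmap N he) ext; apply: N0 => z.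
  have /ffunP/(_ (Ordinal lt0)) := ext [ffun _ => z] (tup0 _ _ rn1).
  by rewrite !ffunE.
move: ext => /(Ext_texact N he) ext; apply: N0; apply: (nakayama_mod nR hm fN) => z.
have [u /ffunP/(_ (Ordinal lt0))] := ext [ffun _ => z] (tup0 _ _ rn1).
rewrite !ffunE => ->; exists (rk C n), (fun i => (dm C n)^T i (Ordinal lt0)), u; split=> //.
by move=> i; rewrite mxE; exact: mC.
Qed.

Lemma Ext_above M N (C : fcx R) (e : {ffun 'I_(rk C 0) -> M}) n : resolves e ->
  rk C n = 0%N -> Ext_vanishes n M N.
Proof.
move=> he r0; case: n => [|n] in r0 *.
  by apply/(Ext0_tmap N he) => w _; exact: tup0.
by apply/(Ext_texact N he) => w _; exists 0; exact: tup0.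
Qed.

Lemma Tor_finite_pd N (H : fcx R) L (eL : {ffun 'I_(rk H 0) -> L}) d : resolves eL ->
  fin_gen N -> resolution_bounded N d -> exists n, Tor_vanishes n.+1 N L.
Proof.
move=> hL fN hd; have [G [g [hG mG]]] := min_res nR hm fN.
have [gs gk exG] := hG; have [_ _ exH] := hL; pose b := (`|d|.+1)%N.
have G0 j : (b <= j)%N -> rk G j = 0%N.
  move=> bj; apply: (min_res_bounded hm hG mG hd).
  by rewrite -lez_nat in bj; apply: lt_le_trans bj; lia.
(* The images of [dm G j] are syzygies of [N], zero once [b <= j]. Each shift from [j.+1] to [j]
   costs one degree of [H]; [t] counts the shifts. *)
have sh t j n : (b <= j + t)%N -> (t <= n)%N ->
    stexact (fun v => exists u, rmul (dm G j) u = v) (dm H n.+1) (dm H n).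
  elim: t j n => [|t IH] j n bjt tn.
    apply: stexact0; first by exists 0; rewrite linear0.
    move=> _ [u <-]; rewrite (_ : u = 0) ?linear0 //; apply/rowP => i; exfalso; case: i => i.
    by rewrite G0 // -[j]addn0 leqW.
  case: n tn => // n tn; apply: (stexact_im (exact_cx_zero exH n)).
    move=> w w0 hw; have [|//|u hu ->] := IH j.+1 n _ tn w _ hw.
    - by rewrite addSnnS.
    - by move=> i; have /(exG j)[u ->] := w0 i; exists u.
    by exists u => // i; apply/(exG j); have [v <-] := hu i; exists v.
  by apply: texact_rV; exact: exH.
(* The extra degree pays for the last shift, along [lcomb g] to [N] itself. *)
exists b.+1; apply/(Tor_texact N hL) => w hw.
have [||||u _ ->] := @stexact_im _ _ _ (lcomb g) _ _ _ _ (dm H b.+2) (dm H b.+1) (dm H b) _ _ _ w _ hw.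
- exact: (exact_cx_zero exH).
- move=> v v0 hv; have [|||u hu ->] := @sh b 0%N b _ _ v _ hv.
  + by [].
  + by [].
  + by move=> i; have /gk[u ->] := v0 i; exists u.
  by exists u => // i; apply/gk; have [y <-] := hu i; exists y.
- by apply: texact_rV; exact: exH.
- by move=> i; exact: gs.
by exists u.
Qed.

Lemma Ext_finite_id N (H : fcx R) L (eL : {ffun 'I_(rk H 0) -> L}) : resolves eL ->
  (injdim N < +oo)%E -> exists b : nat, forall n : nat, (b <= n)%N -> Ext_vanishes n.+1 L N.
Proof.
move=> hL /inf_bar_lty[d [I zI]]; have [_ _ exH] := hL; pose b := (`|d|.+1)%N.
have H0 n : (dm H n)^T *m (dm H n.+1)^T = 0.
  by rewrite -trmx_mul (exact_cx_zero exH) trmx0.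
have inj j n : texact (iobj I j) (dm H n)^T (dm H n.+1)^T.
  by apply: texact_injective (exH n); exact: iobj_injective.
(* The same induction along the cosyzygies of [N], the kernels of [idiff I j]. *)
have sh t j n : (b <= j + t)%N -> (t <= n)%N ->
    stexact (fun x => idiff I j x = 0) (dm H n)^T (dm H n.+1)^T.
  elim: t j n => [|t IH] j n bjt tn.
    apply: stexact0 => [|x _]; first exact: linear0.
    by apply: zI; rewrite addn0 -lez_nat in bjt; apply: lt_le_trans bjt; lia.
  case: n tn => // n tn; apply: (stexact_ker (H0 n)); last exact: inj.
  move=> w w0 hw; have [|//|u hu ->] := IH j.+1 n _ tn w _ hw.
  - by rewrite addSnnS.
  - by move=> i; apply/idiff_exact.
  by exists u => // i; apply/idiff_exact.
exists b => n bn; apply/(Ext_texact N hL) => w hw.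
have [//|i||u hu eu] := @sh b 0%N n _ bn (tlin (iaug I) w).
- by rewrite ffunE; apply/iaug_exact; exists (w i).
- by rewrite tmap_lin hw; apply/ffunP => i; rewrite !ffunE linear0.
have [y ey] : exists y, tlin (iaug I) y = u.
  by apply: tlin_lift => i; apply/iaug_exact.
exists y; apply/ffunP => i; apply: (@iaug_inj _ _ I).
by move/ffunP/(_ i): eu; rewrite -ey tmap_lin !ffunE.
Qed.

(* Here [L] is the residue field. *)
Lemma residue_resolution : exists e (x : {ffun 'I_e -> R^o}) (L : lmodType R) (H : fcx R)
    (eL : {ffun 'I_(rk H 0) -> L}),
  [/\ forall a, m a <-> exists v, lcomb x v = a, fin_gen L, resolves eL, min_cx m H &
      rk H 0 <> 0%N] /\ rk H e <> 0%N.
Proof.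
have [e [x [gx mx]]] := min_gen_ideal.
pose D : 'M[R]_(e, 1) := \col_i x i.
have xD v : lcomb x v = (v *m D) 0 0.
  by rewrite mxE; apply: eq_bigr => i _; rewrite mxE.
have [G [B [hB GB exG mG]]] := min_res_sub nR hm (submod_ker (rmul D)).
have BD : mexact B D by move=> v; exact: hB.
have hL := coker_resolves GB exG BD; have [_ _ exH] := hL.
have mH : min_cx m (fcons (C := fcons B) D).
  case=> [|[|i]]; last exact: mG.
    by move=> i j; rewrite mxE; apply/gx; exists (delta_mx 0 i); exact: lcomb_delta.
  move=> i j; have /mx/(_ j) : lcomb x (row i B) = 0.
    by rewrite xD -row_mul (mexact_mul0 BD) row0 mxE.
  by rewrite mxE.
exists e, x, (coker D), (fcons (C := fcons B) D), (coker_gens D); split.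
  by split=> //; exact: coker_fin_gen.
apply: (residue_rank hm exH mH _ gx mx) => // j.
exists (delta_mx 0 j); rewrite /= -rowE.
by apply/rowP => k; rewrite !mxE !ord1 eqxx mulr1n.
Qed.

End RigidTest.

Lemma min_res_top (R : comNzRingType) (C : fcx R) n : rk C 0 <> 0%N -> rk C n = 0%N ->
  exists d, [/\ (d < n)%N, rk C d <> 0%N & rk C d.+1 = 0%N].
Proof.
move=> C0 Cn; have exz : exists i, rk C i == 0%N by exists n; apply/eqP.
case: (ex_minnP exz) => [[|d]] /eqP rd dmin //; exists d; split=> //.
  by apply: dmin; apply/eqP.
by move=> /eqP/dmin; rewrite ltnn.
Qed.

Lemma regular_of_finite (R : comNzRingType) (mb : {pred R}) e (x : {ffun 'I_e -> R^o}) (H : fcx R) n :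
  noeth R^o -> is_local (fun a => a \in mb) ->
  (forall a, a \in mb <-> exists v, lcomb x v = a) -> exact_cx H ->
  min_cx (fun a => a \in mb) H ->
  rk H 0 <> 0%N -> rk H e <> 0%N -> rk H n = 0%N -> regular_local mb.
Proof.
move=> nR hm gx exH mH H0 He Hn; have [p [_ rp rp1]] := min_res_top H0 Hn.
have ep : (e <= p)%N.
  by rewrite leqNgt; apply/negP => /(min_res_rk0 hm exH mH rp1).
have fR : fin_gen R^o.
  exists [:: 1] => a; exists (fun _ => a).
  by rewrite big_ord1 /= /GRing.scale /= mulr1.
have R0 : ~ zero_module R^o by move=> /(_ 1)/eqP; rewrite oner_eq0.
have [|s [sm reg sp]] := depth_complex nR hm fR R0 (exact_cx_zero exH) mH _ rp rp1.
  by move=> i; apply: texact_R; exact: exH.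
have [q hq] := regular_seq_pchain nR hm fR sm reg.
have bound k (a b : R -> Prop) : pchain k a b -> (k <= e)%N by exact: pchain_min_gens gx.
have pe : p = e by apply/eqP; rewrite eqn_leq ep -{1}sp (bound _ _ _ hq).
rewrite sp pe in hq.
exists (codom x) => [a|].
  by rewrite gx lcomb_span; exact: spanP.
rewrite size_codom card_ord; apply: sup_bar_eq => [_ [k [P hP] <-]|t ht].
  by rewrite lee_fin lez_nat; exact: bound (prime_chain_pchain hP).
by apply: ht; exists e => //; have [P [hP _]] := pchain_seq hq; exists P.
Qed.

Theorem theorem1p1 (R : comNzRingType) (m : {pred R})
    (hnoeth : noetherian R) (hloc : local_ring m)
    (M N : lmodType R)
    (hM : fin_gen M) (hN : fin_gen N)
    (hM0 : ~ zero_module M) (hN0 : ~ zero_module N)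
    (hrt : rigid_test N) :
  [/\ forall n : int, (depth m N <= n%:E)%E -> Ext_vanishes n M N ->
        (pd M <= (n - 1)%:E)%E,
      pd M = sup_bar [set i%:E | i in [set i : int | ~ Ext_vanishes i M N]]
    & (pd N < +oo)%E \/ (injdim N < +oo)%E -> regular_local m].
Proof.
have nR := noeth_ring hnoeth; have hm := local_ringP hnoeth hloc.
have [D [depD depN]] := depth_fin nR hm (fun a => iff_refl (a \in m)) hN hN0.
have [C [e [he mC]]] := min_res nR hm hM; have C0 := min_res_rk0_neq0 he hM0.
have [_ _ exC] := he.
have rigid k : (D <= k)%N -> Ext_vanishes k M N -> rk C k = 0%N.
  move=> Dk; apply: (Ext_rigidity nR hm he mC hrt hN0) => s sm reg.
  exact: leq_trans (depN s sm reg) Dk.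
split.
(* A negative [n] is never at least the natural number [D]. *)
- case=> [k|k]; rewrite depD lee_fin // lez_nat => Dk /(rigid k Dk)/(min_res_top C0)[d [dk rd rd1]].
  by rewrite (pd_min_res hm he mC rd rd1) lee_fin; lia.
- have [[n Cn]|/forallNP Cn] := pselect (exists n, rk C n = 0%N).
    have [d [_ rd rd1]] := min_res_top C0 Cn; rewrite (pd_min_res hm he mC rd rd1).
    apply/esym/sup_bar_eq => [_ [[k|k] /= nE <-]|t]; [| by case: nE |].
      rewrite lee_fin lez_nat leqNgt; apply/negP => dk; apply: nE.
      exact: (Ext_above N he) (min_res_rk0 hm exC mC rd1 dk).
    by apply; exists d%:Z => //=; exact: (Ext_top_nonzero nR hm he mC hN hN0 rd rd1).
  rewrite (pd_infinite hm he mC Cn); apply/esym/sup_bar_eq => [x _|t ht]; first exact: leey.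
  (* By [rigid] no Ext in degree [D] or above vanishes, so only +oo can bound the degrees. *)
  have {}ht k : (D <= k)%N -> ((k%:Z)%:E <= t)%E.
    by move=> Dk; apply: ht; exists k%:Z => //= /(rigid k Dk)/Cn.
  case: t ht => [r|//|] ht; last by have := ht D (leqnn _); rewrite leeNy_eq.
  have := ht (maxn D (`|r|.+1)%N) (leq_maxl _ _); rewrite lee_fin => h.
  by exfalso; lia.
- move=> fin; have [f [x [L [H [eL [[gx fL hL mH H0] He]]]]]] := residue_resolution nR hm.
  have [_ _ exH] := hL.
  suff [n Hn] : exists n, rk H n = 0%N by exact: regular_of_finite nR hm gx exH mH H0 He Hn.
  case: fin => [/inf_bar_lty[d hd]|/(Ext_finite_id hL)[b hb]].
    have [k hk] := Tor_finite_pd nR hm hL hN hd.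
    have [d' hd'] := rigid_resolution hrt fL hk.
    by exists (`|d'|.+1)%N; apply: (min_res_bounded hm hL mH hd'); lia.
  (* The successor matches the degree [n.+1] in [Ext_finite_id]; [D] ensures the depth condition. *)
  exists (maxn b D).+1; apply: (Ext_rigidity nR hm hL mH hrt hN0) => [s sm reg|].
    by apply: leq_trans (depN s sm reg) _; rewrite leqW // leq_maxr.
  by apply: hb; exact: leq_maxl.
Qed.
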